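(* Assume that $Y_V$ satisfies the spectral density condition and is purely non-deterministic, and let $G_{OG}=(V,E_{OG})$ be the orthogonality graph for $Y_V$. Then $Y_V$ satisfies the global Markov property with respect to $G_{OG}$, i.e., for all disjoint subsets $A,B,C\subseteq V$ the following hold: (a) If every $B$-pointing path in $G_{OG}$ between $A$ and $B$ is $m$-blocked given $B\cup C$, then $Y_A\not\to Y_B\mid Y_{A\cup B\cup C}$. (b) If $a\,\text{-}\,\text{-}\,b\notin E_{OG}$ for all $a\in A$ and $b\in B$, and if every bi-pointing path in $G_{OG}$ between $A$ and $B$ is $m$-blocked given $A\cup B\cup C$, then $Y_A\not\sim Y_B\mid Y_{A\cup B\cup C}$.
   Context: $V=\{1,\ldots,k\}$ and $Y_V=(Y_V(t))_{t\in\mathbb{R}}$ is a $k$-dimensional weakly stationary process with expectation zero, continuous in mean square, with components $Y_v$ and subprocesses $Y_A=(Y_a)_{a\in A}$. $L^2$ is the Hilbert space of square-integrable complex random variables with $\langle X,Y\rangle=\mathbb{E}[X\overline{Y}]$; $P_{\mathcal L}$ is orthogonal projection onto a closed subspace. $\mathcal{L}_{Y_A}(s,t)$ is the closed linear span of $\{Y_a(u):a\in A,u\in[s,t]\cap\mathbb{R}\}$ and $\mathcal{L}_{Y_A}(t)=\mathcal{L}_{Y_A}(-\infty,t)$ ($=\{0\}$ if $A=\emptyset$). $\mathcal{L}_1\perp\mathcal{L}_2\mid\mathcal{L}_3$ means $\mathbb{E}[(X-P_{\mathcal{L}_3}X)\overline{(Y-P_{\mathcal{L}_3}Y)}]=0$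 for all $X\in\mathcal{L}_1,Y\in\mathcal{L}_2$. For $A,B\subseteq S\subseteq V$, $A\cap B=\emptyset$: $Y_A\not\to Y_B\mid Y_S$ means $\mathcal{L}_{Y_B}(t,t+1)\perp\mathcal{L}_{Y_A}(t)\mid\mathcal{L}_{Y_{S\setminus A}}(t)$ for all $t\in\mathbb{R}$; $Y_A\not\sim Y_B\mid Y_S$ means $\mathcal{L}_{Y_A}(t,t+1)\perp\mathcal{L}_{Y_B}(t,t+1)\mid\mathcal{L}_{Y_S}(t)$ for all $t\in\mathbb{R}$. Spectral density condition: $Y_V$ has a spectral density matrix $f_{Y_VY_V}(\cdot)>0$ (positive definite) and there is $0<\varepsilon<1$ such that $(1-\varepsilon)I_\alpha-f_{Y_AY_A}(\lambda)^{-1/2}f_{Y_AY_B}(\lambda)f_{Y_BY_B}(\lambda)^{-1}f_{Y_BY_A}(\lambda)f_{Y_AY_A}(\lambda)^{-1/2}$ is positive semi-definite for almost all $\lambda\in\mathbb{R}$ and all disjoint $A,B\subseteq V$, $\#A=\alpha$ ($f_{Y_AY_B}$ is the $A\times B$ block of $f_{Y_VY_V}$). Purely non-deterministic: $\bigcap_{t\in\mathbb{R}}\mathcal{L}_{Y_V}(t)=\{0\}$. Orthogonality graph $G_{OG}=(V,E_{OG})$: mixed graph with vertex set $V$ where, for $a\neq b$, $a\to b\notin E_{OG}$ iff $Y_a\not\to Y_b\mid Y_V$, and the undirected (dashed) edge $a\,\text{-}\,\text{-}\,b\notin E_{OG}$ iff $Y_a\not\sim Y_b\mid Y_V$. Paths: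 a path between vertices $a$ and $b$ is a sequence $\langle e_1,\ldots,e_n\rangle$ of edges such that $e_i$ is an edge between $v_{i-1}$ and $v_i$ for some sequence of (not necessarily distinct) vertices $a=v_0,v_1,\ldots,v_n=b$; $v_1,\ldots,v_{n-1}$ are the intermediate vertices. An intermediate vertex $c$ is a collider on the path if the edges preceding and succeeding it both have an arrowhead or a dashed tail at $c$, otherwise a non-collider. A path is $m$-connecting given a set $S$ if every non-collider on it is not in $S$ and every collider on it is in $S$; otherwise it is $m$-blocked given $S$. A path between $a$ and $b$ is $b$-pointing if it has an arrowhead at the endpoint $b$; a path between $A$ and $B$ (i.e. between some $a\in A$ and some $b\in B$) is $B$-pointing if it is $b$-pointing for its endpoint $b\in B$; a path is bi-pointing if it has an arrowhead at both endpoints. *)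

(* Defs.v *)
From HB Require Import structures.
From mathcomp Require Export all_boot all_order all_algebra.
From mathcomp Require Export all_classical all_reals all_analysis.
From mathcomp.real_closed Require Export complex.

Set Implicit Arguments.
Unset Strict Implicit.
Unset Printing Implicit Defensive.

Export Order.TTheory GRing.Theory Num.Theory.
Export numFieldNormedType.Exports.
Local Open Scope classical_set_scope.
Global Open Scope ring_scope.
Local Open Scope complex_scope.
Local Open Scope sesquilinear_scope.

Section ComplexIntegral.
Context (R : realType) (d : measure_display) (T : measurableType d)
        (mu : {measure set T -> \bar R}).
Implicit Types (f X Y : T -> R[i]).

Definition cintegrable f : Prop :=
  mu.-integrable setT (EFin \o (fun x => complex.Re (f x))) /\
  mu.-integrable setT (EFin \o (fun x => complex.Im (f x))).

Definition cintegral f : R[i] :=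
  Rintegral mu setT (fun x => complex.Re (f x)) +i* Rintegral mu setT (fun x => complex.Im (f x)).

(* Square-integrable functions; random variables that agree almost surely are
   not identified, so the zero space is the set of a.s. zero functions. *)
Definition sq_integrable : set (T -> R[i]) :=
  [set X | (fun x => complex.Re (X x)) \in Lfun mu 2%:E /\
           (fun x => complex.Im (X x)) \in Lfun mu 2%:E].

Definition zero_space : set (T -> R[i]) :=
  [set X | sq_integrable X /\ {ae mu, forall x, X x = 0}].

Definition inner X Y : R[i] := cintegral (fun x => X x * (Y x)^*).

Definition L2norm X : R := Num.sqrt (complex.Re (inner X X)).

Definition linear_span (G : set (T -> R[i])) : set (T -> R[i]) :=
  [set Z | exists (n : nat) (c : 'I_n -> R[i]) (g : 'I_n -> T -> R[i]),
     (forall i, G (g i)) /\ Z = (fun x => \sum_(i < n) c i * g i x)].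

Definition closed_span (G : set (T -> R[i])) : set (T -> R[i]) :=
  [set X | sq_integrable X /\
     forall e : R, 0 < e ->
       exists2 Z, linear_span G Z & L2norm (X \- Z) < e].

(* A representative of the orthogonal projection of X onto the closed
   subspace L; it is unique up to almost sure equality. *)
Definition proj (L : set (T -> R[i])) X : T -> R[i] :=
  xget (fun=> 0) [set Z | L Z /\ forall W, L W -> inner (X \- Z) W = 0].

Definition cond_orth (L1 L2 L3 : set (T -> R[i])) : Prop :=
  forall X Y, L1 X -> L2 Y -> inner (X \- proj L3 X) (Y \- proj L3 Y) = 0.

End ComplexIntegral.

Section Process.
Context (R : realType) (d : measure_display) (T : measurableType d)
        (P : probability T R) (k : nat).
Variable Y : 'I_k -> R -> T -> R[i].
Implicit Types (A B S : {set 'I_k}) (I : set R).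

Definition centered_weakly_stationary : Prop :=
  [/\ forall v t, sq_integrable P (Y v t),
      forall v t, cintegral P (Y v t) = 0 &
      forall a b s t h,
        inner P (Y a (s + h)) (Y b (t + h)) = inner P (Y a s) (Y b t)].

Definition mean_square_continuous : Prop :=
  forall v t, L2norm P (Y v s \- Y v t) @[s --> t] --> (0 : R).

(* The closed span of the Y_a(u) with a \in A and u \in I; it is the zero space
   when A is empty. *)
Definition Lspace A I : set (T -> R[i]) :=
  closed_span P [set X | exists2 a, a \in A & exists2 u, I u & X = Y a u].

Definition Lpast A (t : R) := Lspace A `]-oo, t].

Definition purely_nondeterministic : Prop :=
  \bigcap_(t in [set: R]) Lpast [set: 'I_k]%SET t = zero_space P.

Definition not_causal A B S : Prop :=
  forall t : R,
    cond_orth P (Lspace B `[t, t + 1]) (Lpast A t) (Lpast (S :\: A)%SET t).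

Definition not_contemporaneous A B S : Prop :=
  forall t : R,
    cond_orth P (Lspace A `[t, t + 1]) (Lspace B `[t, t + 1]) (Lpast S t).

End Process.

Section Spectral.
Context (R : realType).

(* On R[i], 0 < z and 0 <= z include that z is real, so both notions below
   force M to be Hermitian. *)
Definition pos_def n (M : 'M[R[i]]_n) : Prop :=
  forall x : 'cV[R[i]]_n, x != 0 -> 0 < (x ^t* *m M *m x) 0 0.

Definition pos_semidef n (M : 'M[R[i]]_n) : Prop :=
  forall x : 'cV[R[i]]_n, 0 <= (x ^t* *m M *m x) 0 0.

(* M^{-1/2}: the positive definite square root of the inverse, unique when M is
   positive definite. *)
Definition inv_sqrtmx n (M : 'M[R[i]]_n) : 'M[R[i]]_n :=
  xget 0 [set N | pos_def N /\ N *m N = invmx M].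

Definition block k (M : 'M[R[i]]_k) (A B : {set 'I_k}) : 'M[R[i]]_(#|A|, #|B|) :=
  \matrix_(i, j) M (enum_val i) (enum_val j).

Definition expi (x : R) : R[i] := cos x +i* sin x.

(* c(h) = \int e^{i l h} f(l) dl, where c(h)_{ab} = E[Y_a(t+h) conj(Y_b(t))]. *)
Definition spectral_density (d : measure_display) (T : measurableType d)
    (P : probability T R) k (Y : 'I_k -> R -> T -> R[i])
    (f : R -> 'M[R[i]]_k) : Prop :=
  forall a b,
    cintegrable (@lebesgue_measure R) (fun l => f l a b) /\
    forall t h, inner P (Y a (t + h)) (Y b t) =
      cintegral (@lebesgue_measure R) (fun l => expi (l * h) * f l a b).

Definition spectral_density_condition (d : measure_display)
    (T : measurableType d) (P : probability T R) k
    (Y : 'I_k -> R -> T -> R[i]) : Prop :=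
  exists f : R -> 'M[R[i]]_k,
    [/\ spectral_density P Y f,
        forall l, pos_def (f l) &
        exists eps : R, 0 < eps < 1 /\
          forall A B : {set 'I_k}, [disjoint A & B]%B ->
            {ae @lebesgue_measure R, forall l,
               pos_semidef ((1 - eps)%:C%:M
                 - inv_sqrtmx (block (f l) A A) *m block (f l) A B
                   *m invmx (block (f l) B B) *m block (f l) B A
                   *m inv_sqrtmx (block (f l) A A))}].

End Spectral.

(* Undirected edges are given by a relation, which is meant to be symmetric. *)
Record mixed_graph (V : Type) := MixedGraph {
  directed : V -> V -> Prop;
  dashed : V -> V -> Prop }.

(* For cond_orth the two first spaces may be exchanged (complex conjugation), so
   that the dashed edges below are symmetric. *)
Definition orthogonality_graph (R : realType) (d : measure_display)
    (T : measurableType d) (P : probability T R) k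
    (Y : 'I_k -> R -> T -> R[i]) : mixed_graph 'I_k :=
  {| directed a b := a != b /\
       ~ not_causal P Y [set a]%SET [set b]%SET [set: 'I_k]%SET;
     dashed a b := a != b /\
       ~ not_contemporaneous P Y [set a]%SET [set b]%SET [set: 'I_k]%SET |}.

Section Paths.
Context (V : finType) (G : mixed_graph V).

(* The edge traversed from u to v is u -> v, u <- v or u -- v. *)
Inductive step := Forward | Backward | Dashed.
Inductive mark := Arrowhead | Tail | DashedTail.

Definition is_edge u e v : Prop :=
  match e with
  | Forward => directed G u v
  | Backward => directed G v u
  | Dashed => dashed G u v
  end.

Definition src_mark e :=
  match e with
  | Forward => Tail | Backward => Arrowhead | Dashed => DashedTail
  end.

Definition tgt_mark e :=
  match e with
  | Forward => Arrowhead | Backward => Tail | Dashed => DashedTail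
  end.

Definition is_arrowhead m := if m is Arrowhead then true else false.
Definition is_tail m := if m is Tail then true else false.

(* A walk from v_0 is the list of the pairs (e_i, v_i), i = 1, ..., n. *)
Fixpoint is_walk (u : V) (p : seq (step * V)) : Prop :=
  if p is (e, v) :: p' then is_edge u e v /\ is_walk v p' else True.

Definition is_path (a b : V) (p : seq (step * V)) : Prop :=
  [/\ p <> [::], is_walk a p & last a [seq x.2 | x <- p] = b].

(* Both marks at the intermediate vertex are an arrowhead or a dashed tail. *)
Definition collider (e e' : step) : bool :=
  ~~ is_tail (tgt_mark e) && ~~ is_tail (src_mark e').

Fixpoint m_connecting (S : {set V}) (p : seq (step * V)) : Prop :=
  if p is (e, c) :: p' then
    (if p' is (e', _) :: _ then
       if collider e e' then c \in S else c \notin S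
     else True) /\ m_connecting S p'
  else True.

Definition m_blocked (S : {set V}) p : Prop := ~ m_connecting S p.

Definition head_at_start (p : seq (step * V)) : bool :=
  if p is (e, _) :: _ then is_arrowhead (src_mark e) else false.

Definition head_at_end (p : seq (step * V)) : bool :=
  if rev p is (e, _) :: _ then is_arrowhead (tgt_mark e) else false.

Definition bi_pointing p : bool := head_at_start p && head_at_end p.

End Paths.

(* Main.v *)
From HB Require Import structures.
Require Import Defs.
From mathcomp Require Import ring lra measurable_realfun.

(** The random variables of finite variance form a complete space with a
    semi-inner product, and the theorem is about closed subspaces of it, generated
    by the components of the process over intervals of time.  The proof is carried
    out for a process with values in an abstract space of this kind.  Two
    consequences of the assumptions on [Y] enter.

    - Positive angles: if [D] and [E] are disjoint, then [|x|^2 <= K |x + z|^2] for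
      [x] and [z] in the spaces of the components in [D] and in [E].  For finite
      linear combinations, the squared norm is the integral over the frequencies of
      the quadratic form of the spectral density matrix, and the spectral density
      condition bounds its Schur complement from below ([schur_bound],
      [spectral_angle]).  So sums of such spaces are closed and direct, and the
      pasts of [S] and [S'] intersect in the past of [S :&: S'] ([pastI]).
    - Pure non-determinism: the past of [S] at time [t] is the intersection over [n]
      of its closed sums with the past of all components at [t - n]
      ([past_remote]).

    By the first one, a component over [[t, t + 1]] is predicted, from the past of
    all components at [t], by its own past and that of its parents in the
    orthogonality graph ([prediction_local]).  What remains is an innovation,
    orthogonal to this past.  Innovations of distinct components that are not
    joined by a dashed edge are orthogonal.

    The heart of the proof is [m_separated_cond_ortho]: if all paths between [D] and [E] are
    blocked given [S], the pasts of [D] and [E] at [t] are conditionally orthogonal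
    given that of [S].  Enlarge [D] and [E], within the ancestral set of all three,
    and cut [S] in two parts, each the business of one side: [D] with its part of
    [S] has its parents in [D] and [S], likewise for [E], and there is no dashed edge
    between the two sides ([m_separated_split]).  Fix a starting time [s] and condition in
    addition on the past of everything at [s].  At time [s] the claim is trivial, and
    it propagates from [t] to [t + 1], since each side is a prediction from its own
    past plus innovations, and the innovations of the two sides are orthogonal
    ([cond_ortho_evolve]).  Then [s] tends to minus infinity.

    For the theorem, predict the components in [B] (and in [A] for the second part)
    from their parents.  Parents in the conditioning set do no harm, and those
    outside it are separated from [A] (or from the parents of [A]), because a path
    that is open up to such a parent stays open when an edge into [B] (or [A]) is
    appended: the parent is a non-collider on the longer path. *)

Set Implicit Arguments.
Unset Strict Implicit.
Unset Printing Implicit Defensive.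
Local Open Scope classical_set_scope.
Local Open Scope complex_scope.

(** * Complex numbers as pairs of reals *)

Local Notation Re := (@complex.Re _).
Local Notation Im := (@complex.Im _).

Section ComplexParts.
Context (R : realType).
Implicit Types z w : R[i].

Lemma ReD z w : Re (z + w) = Re z + Re w. Proof. by case: z w => [? ?] []. Qed.
Lemma ImD z w : Im (z + w) = Im z + Im w. Proof. by case: z w => [? ?] []. Qed.
Lemma ReN z : Re (- z) = - Re z. Proof. by case: z. Qed.
Lemma ImN z : Im (- z) = - Im z. Proof. by case: z. Qed.
Lemma ReM z w : Re (z * w) = Re z * Re w - Im z * Im w.
Proof. by case: z w => [? ?] []. Qed.
Lemma ImM z w : Im (z * w) = Re z * Im w + Im z * Re w.
Proof. by case: z w => [? ?] []. Qed.
Lemma ReJ z : Re z^* = Re z. Proof. by case: z. Qed.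
Lemma ImJ z : Im z^* = - Im z. Proof. by case: z. Qed.

Lemma complexP z w : Re z = Re w -> Im z = Im w -> z = w.
Proof. by case: z w => [? ?] [? ?] /= -> ->. Qed.

Lemma complex_ge0P z : reflect (Im z = 0 /\ 0 <= Re z) (0 <= z).
Proof. by case: z => a b; rewrite lecE /=; apply: (iffP andP) => -[/eqP]. Qed.

Definition sqabs z : R := Re z ^+ 2 + Im z ^+ 2.

Lemma sqabs_ge0 z : 0 <= sqabs z.
Proof. by rewrite addr_ge0 ?sqr_ge0. Qed.

Lemma sqabs_gt0 z : z != 0 -> 0 < sqabs z.
Proof.
case: z => a b; rewrite eq_complex /= lt_def sqabs_ge0 andbT /sqabs /=.
by rewrite paddr_eq0 ?sqr_ge0 // !sqrf_eq0.
Qed.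

Lemma sqabsD z w : sqabs (z + w) <= 2 * sqabs z + 2 * sqabs w.
Proof.
case: z w => [a b] [c d]; rewrite /sqabs /=.
have := sqr_ge0 (a - c); have := sqr_ge0 (b - d); nra.
Qed.

End ComplexParts.

(** * Complete spaces with a semi-inner product *)

(** The elements are not identified when their difference has norm zero, as is
    the case for random variables. *)
Record semiHilbert (R : realType) := SemiHilbert {
  carrier :> lmodType R[i];
  ip : carrier -> carrier -> R[i];
  ipDl : forall x y z : carrier, ip (x + y) z = ip x z + ip y z;
  ipZl : forall c (x z : carrier), ip (c *: x) z = c * ip x z;
  ipC : forall x y : carrier, ip y x = (ip x y)^*;
  ip_ge0 : forall x : carrier, 0 <= ip x x;
  ip_complete : forall u : nat -> carrier,
    (forall e : R, 0 < e -> exists n0, forall m n, (n0 <= m)%N -> (n0 <= n)%N ->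
       Re (ip (u m - u n) (u m - u n)) < e) ->
    exists x, forall e : R, 0 < e -> exists n0, forall n, (n0 <= n)%N ->
       Re (ip (u n - x) (u n - x)) < e }.

Section SemiInnerProduct.
Context (R : realType) (H : semiHilbert R).
Implicit Types (x y z w : H) (c : R[i]).

Definition sqnorm x : R := Re (ip x x).

Lemma ip0l z : ip 0 z = 0.
Proof. by rewrite -(scale0r (0 : H)) ipZl mul0r. Qed.

Lemma ipNl x z : ip (- x) z = - ip x z.
Proof. by rewrite -scaleN1r ipZl mulN1r. Qed.

Lemma ipBl x y z : ip (x - y) z = ip x z - ip y z.
Proof. by rewrite ipDl ipNl. Qed.

Lemma ip0r z : ip z 0 = 0.
Proof. by rewrite ipC ip0l rmorph0. Qed.

Lemma ipDr x y z : ip z (x + y) = ip z x + ip z y.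
Proof. by rewrite ipC ipDl rmorphD /= -!ipC. Qed.

Lemma ipNr x z : ip z (- x) = - ip z x.
Proof. by rewrite ipC ipNl rmorphN /= -ipC. Qed.

Lemma ipBr x y z : ip z (x - y) = ip z x - ip z y.
Proof. by rewrite ipDr ipNr. Qed.

Lemma ipZr c x z : ip z (c *: x) = c^* * ip z x.
Proof. by rewrite ipC ipZl rmorphM /= -ipC. Qed.

Lemma ip_eq0C x y : ip x y = 0 -> ip y x = 0.
Proof. by move=> xy; rewrite ipC xy rmorph0. Qed.

Lemma sqnorm_ge0 x : 0 <= sqnorm x.
Proof. by case/complex_ge0P: (ip_ge0 x). Qed.

Lemma ipxx x : ip x x = (sqnorm x)%:C.
Proof. by apply: complexP => //=; case/complex_ge0P: (ip_ge0 x). Qed.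

Lemma sqnormN x : sqnorm (- x) = sqnorm x.
Proof. by rewrite /sqnorm ipNl ipNr opprK. Qed.

Lemma sqnorm_subC x y : sqnorm (x - y) = sqnorm (y - x).
Proof. by rewrite -sqnormN opprB. Qed.

Lemma sqnorm0 : sqnorm 0 = 0. Proof. by rewrite /sqnorm ip0l. Qed.

Lemma sqnormD x y : sqnorm (x + y) = sqnorm x + sqnorm y + 2 * Re (ip x y).
Proof. by rewrite /sqnorm ipDl !ipDr !ReD (ipC x y) ReJ; lra. Qed.

Lemma sqnormB x y : sqnorm (x - y) = sqnorm x + sqnorm y - 2 * Re (ip x y).
Proof. by rewrite sqnormD sqnormN ipNr ReN; lra. Qed.

Lemma sqnormZ c x : sqnorm (c *: x) = sqabs c * sqnorm x.
Proof.
by rewrite /sqnorm ipZl ipZr mulrA ipxx /sqabs; case: c => a b /=; lra.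
Qed.

Lemma sqnormD_le x y : sqnorm (x + y) <= 2 * sqnorm x + 2 * sqnorm y.
Proof. by have := sqnorm_ge0 (x - y); rewrite sqnormB sqnormD; lra. Qed.

Lemma sqnorm_trans y x z : sqnorm (x - z) <= 2 * sqnorm (x - y) + 2 * sqnorm (y - z).
Proof. by rewrite -(subrKA y x) sqnormD_le. Qed.

Lemma pythagoras x y : ip x y = 0 -> sqnorm (x + y) = sqnorm x + sqnorm y.
Proof. by move=> xy; rewrite sqnormD xy /=; lra. Qed.

(** Moving [x] along [w] by this multiple of [(x, w)] shortens it by at least
    the stated amount.  With a nonnegative left-hand side this is a weak form of
    the Cauchy-Schwarz inequality; for a best approximation it gives
    orthogonality. *)
Lemma sqnorm_step x w :
  sqnorm (x - ((1 + sqnorm w)^-1%:C * ip x w) *: w) <=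
  sqnorm x - (1 + sqnorm w)^-1 * sqabs (ip x w).
Proof.
have w0 := sqnorm_ge0 w; set t := (1 + sqnorm w)^-1.
have t0 : 0 < t by rewrite invr_gt0; lra.
have te : t * (1 + sqnorm w) = 1 by rewrite mulVf //; lra.
have -> : sqnorm (x - (t%:C * ip x w) *: w) =
    sqnorm x - (2 * t - t ^+ 2 * sqnorm w) * sqabs (ip x w).
  rewrite sqnormB sqnormZ ipZr /sqabs; case: (ip x w) => a b /=; lra.
have -> : 2 * t - t ^+ 2 * sqnorm w = t + t ^+ 2 by rewrite expr2; nra.
have := mulr_ge0 (sqr_ge0 t) (sqabs_ge0 (ip x w)); lra.
Qed.

Lemma sqabs_ip_le x w : sqabs (ip x w) <= (1 + sqnorm w) * sqnorm x.
Proof.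
have w1 : 0 < 1 + sqnorm w by have := sqnorm_ge0 w; lra.
by have := le_trans (sqnorm_ge0 _) (sqnorm_step x w); rewrite subr_ge0 ler_pdivrMl.
Qed.

Lemma null_ip x w : sqnorm x = 0 -> ip x w = 0.
Proof.
move=> x0; apply/eqP; apply: contraT => /sqabs_gt0.
by have := sqabs_ip_le x w; rewrite x0 mulr0 => /le_lt_trans h /h; rewrite ltxx.
Qed.

Lemma null_ipr x w : sqnorm x = 0 -> ip w x = 0.
Proof. by move=> /null_ip h; apply/ip_eq0C. Qed.

(** Orthogonality to [w] passes to limits. *)
Lemma ip_approx x w :
  (forall e : R, 0 < e -> exists2 z, ip z w = 0 & sqnorm (x - z) < e) -> ip x w = 0.
Proof.
move=> h; apply/eqP; apply: contraT => /sqabs_gt0 c0.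
have w1 : 0 < 1 + sqnorm w by have := sqnorm_ge0 w; lra.
have [z zw] := h _ (divr_gt0 c0 w1); rewrite ltr_pdivlMr // => zx.
by have := sqabs_ip_le (x - z) w; rewrite ipBl zw subr0; nra.
Qed.

Lemma ip_suml (I : Type) (r : seq I) (F : I -> H) z :
  ip (\sum_(i <- r) F i) z = \sum_(i <- r) ip (F i) z.
Proof.
by apply: (big_morph (fun x => ip x z)) => [x y|]; [rewrite ipDl | rewrite ip0l].
Qed.

Lemma ip_sumr (I : Type) (r : seq I) (F : I -> H) z :
  ip z (\sum_(i <- r) F i) = \sum_(i <- r) ip z (F i).
Proof.
by apply: (big_morph (fun x => ip z x)) => [x y|]; [rewrite ipDr | rewrite ip0r].
Qed.

Lemma ip_null_congr (x p p' z q q' : H) : sqnorm (p - p') = 0 -> sqnorm (q - q') = 0 ->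
  ip (x - p') (z - q') = ip (x - p) (z - q).
Proof.
move=> hp hq; rewrite -(subrKA p x (- p')) -(subrKA q z (- q')).
by rewrite [LHS]ipDl (null_ip _ hp) addr0 [LHS]ipDr (null_ipr _ hq) addr0.
Qed.

End SemiInnerProduct.

(** * Closed subspaces and orthogonal projections *)

Section ClosedSubspaces.
Context (R : realType) (H : semiHilbert R).
Implicit Types (x y z w : H) (c : R[i]) (L G : set H).

(** Membership in the closure of [G]; the squared norm serves as distance
    throughout, which only changes the constants of the triangle inequality. *)
Definition approximable G x := forall e : R, 0 < e -> exists2 z, G z & sqnorm (x - z) < e.

Record closed_subspace L : Prop := ClosedSubspace {
  sub0 : L 0;
  subD : forall x y, L x -> L y -> L (x + y);
  subZ : forall c x, L x -> L (c *: x);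
  sub_lim : forall x, approximable L x -> L x }.

Lemma subN L x : closed_subspace L -> L x -> L (- x).
Proof. by move=> cL Lx; rewrite -scaleN1r; apply: subZ. Qed.

Lemma subB L x y : closed_subspace L -> L x -> L y -> L (x - y).
Proof. by move=> cL Lx Ly; apply: subD => //; apply: subN. Qed.

(** Closed subspaces contain, with an element, everything equal to it up to a
    null element; this replaces equality of classes below. *)
Lemma sub_null L x y : closed_subspace L -> L y -> sqnorm (x - y) = 0 -> L x.
Proof. by move=> cL Ly xy; apply: (sub_lim cL) => e e0; exists y; rewrite ?xy. Qed.

Definition span G z := exists (n : nat) (c : 'I_n -> R[i]) (g : 'I_n -> H),
  (forall i, G (g i)) /\ z = \sum_(i < n) c i *: g i.

Definition cspan G : set H := approximable (span G).

Lemma span_gen G x : G x -> span G x.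
Proof.
by move=> Gx; exists 1%N, (fun=> 1), (fun=> x); rewrite big_ord1 scale1r.
Qed.

Lemma span0 G : span G 0.
Proof.
by exists 0%N, (fun=> 0), (fun=> 0); split=> [[]|] //; rewrite big_ord0.
Qed.

Lemma spanD G x y : span G x -> span G y -> span G (x + y).
Proof.
move=> [n [c [g [Gg ->]]]] [m [c' [g' [Gg' ->]]]].
exists (n + m)%N, (fun i => match fintype.split i with inl j => c j | inr j => c' j end),
  (fun i => match fintype.split i with inl j => g j | inr j => g' j end).
split; first by move=> i; case: (fintype.split i).
rewrite big_split_ord /=; congr (_ + _); apply: eq_bigr => i _.
  by rewrite (unsplitK (inl i)).
by rewrite (unsplitK (inr i)).
Qed.

Lemma spanZ G a x : span G x -> span G (a *: x).
Proof.
move=> [n [c [g [Gg ->]]]]; exists n, (fun i => a * c i), g; split=> //.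
by rewrite scaler_sumr; apply: eq_bigr => i _; rewrite scalerA.
Qed.

Lemma approx_self G x : G x -> approximable G x.
Proof. by move=> Gx e e0; exists x; rewrite // subrr sqnorm0. Qed.

Lemma cspan_gen G x : G x -> cspan G x.
Proof. by move=> /span_gen; apply: approx_self. Qed.

Lemma approx_trans G x : approximable (approximable G) x -> approximable G x.
Proof.
move=> h e e0; have e4 : 0 < e / 4 by lra.
have [y hy xy] := h _ e4; have [z Gz yz] := hy _ e4.
by exists z => //; have := sqnorm_trans y x z; lra.
Qed.

Lemma cspan_subspace G : closed_subspace (cspan G).
Proof.
split=> [|x y hx hy e e0|c x hx e e0|x]; first exact/approx_self/span0.
- have e4 : 0 < e / 4 by lra.
  have [x' Gx xx] := hx _ e4; have [y' Gy yy] := hy _ e4.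
  exists (x' + y'); first exact: spanD.
  by rewrite opprD addrACA; have := sqnormD_le (x - x') (y - y'); lra.
- have s0 := sqabs_ge0 c; have s1 : 0 < 1 + sqabs c by lra.
  have [z Gz xz] := hx _ (divr_gt0 e0 s1); exists (c *: z); first exact: spanZ.
  rewrite -scalerBr sqnormZ; rewrite ltr_pdivlMr // in xz.
  by have := sqnorm_ge0 (x - z); lra.
- exact: approx_trans.
Qed.

Lemma sub_sum L (I : Type) (r : seq I) (F : I -> H) :
  closed_subspace L -> (forall i, L (F i)) -> L (\sum_(i <- r) F i).
Proof.
by move=> cL LF; elim/big_ind: _ => //; [exact: sub0 | exact: subD].
Qed.

Lemma cspan_min G L : closed_subspace L -> G `<=` L -> cspan G `<=` L.
Proof.
move=> cL GL x hx; apply: (sub_lim cL) => e /hx[z [n [c [g [Gg ->]]]] xz].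
exists (\sum_(i < n) c i *: g i) => //.
by apply: sub_sum => // i; apply: subZ => //; apply: GL.
Qed.

Lemma cspan_mono G G' : G `<=` G' -> cspan G `<=` cspan G'.
Proof.
by move=> GG; apply: (cspan_min (cspan_subspace _)) => x /GG; apply: cspan_gen.
Qed.

Lemma ortho_subspace w : closed_subspace [set x | ip x w = 0].
Proof.
split=> /= [|x y xw yw|c x xw|x hx]; first exact: ip0l.
- by rewrite ipDl xw yw addr0.
- by rewrite ipZl xw mulr0.
- exact: ip_approx.
Qed.

Lemma cspan_ortho G w : (forall x, G x -> ip x w = 0) -> forall x, cspan G x -> ip x w = 0.
Proof. by move=> h; apply: (cspan_min (ortho_subspace w)). Qed.

Lemma cspan_ortho_r G w : (forall x, G x -> ip w x = 0) -> forall x, cspan G x -> ip w x = 0.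
Proof.
by move=> h x Gx; apply: ip_eq0C; apply: cspan_ortho Gx => y /h; apply: ip_eq0C.
Qed.

Lemma null_sequence : exists q : nat -> R, (forall n, 0 < q n) /\
  forall e : R, 0 < e -> exists n0, forall n, (n0 <= n)%N -> q n < e.
Proof.
exists (fun n => n.+1%:R^-1); split=> [n|e e0]; first by rewrite invr_gt0.
exists (Num.trunc e^-1) => n hn; rewrite invf_plt ?posrE //.
by apply: lt_le_trans (truncnS_gt _) _; rewrite ler_nat.
Qed.

(** A sequence in [L] whose distance to [x] tends to the infimum is Cauchy by
    the parallelogram law, and [sqnorm_step] makes its limit orthogonal to [L]. *)
Theorem projection_exists L x : closed_subspace L ->
  exists z, L z /\ forall w, L w -> ip (x - z) w = 0.
Proof.
move=> cL; pose D := [set sqnorm (x - z) | z in L]; pose d := inf D.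
have hD : has_inf D.
  split; first by exists (sqnorm (x - 0)), 0 => //; apply: sub0.
  by exists 0 => _ [z _ <-]; apply: sqnorm_ge0.
have dle z : L z -> d <= sqnorm (x - z).
  by move=> Lz; apply: ge_inf; [case: hD | exists z].
have [q [q0 small]] := null_sequence.
have /choice[u hu] n : exists z, L z /\ sqnorm (x - z) < d + q n.
  by have [_ [z Lz <-]] := inf_adherent (q0 n) hD; exists z.
have Lu n : L (u n) by case: (hu n).
have ud n : sqnorm (x - u n) < d + q n by case: (hu n).
have par m n : sqnorm (u m - u n) <= 2 * q m + 2 * q n.
  pose h := (2^-1)%:C *: (u m + u n).
  have := dle h (subZ cL _ (subD cL (Lu m) (Lu n))).
  have -> : x - h = (2^-1)%:C *: ((x - u m) + (x - u n)).
    rewrite addrACA -opprD scalerBr; congr (_ - _).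
    rewrite -[x + x]mulr2n -[x *+ 2]scaler_nat scalerA.
    rewrite -[LHS]scale1r; congr (_ *: _); apply: complexP => /=; lra.
  have -> : u m - u n = (x - u n) - (x - u m) by rewrite opprB [RHS]addrC subrKA.
  rewrite sqnormZ /sqabs /= sqnormD [sqnorm (_ - (x - u m))]sqnormB (ipC (x - u m)) ReJ.
  have -> : (2^-1 ^+ 2 + 0 ^+ 2 : R) = 4^-1 by field.
  by have := ud m; have := ud n; lra.
have [|z uz] := ip_complete (u := u).
  move=> e e0; have [|n0 hn0] := small (e / 4); first lra.
  exists n0 => m n hm hn; apply: le_lt_trans (par m n) _.
  by have := hn0 _ hm; have := hn0 _ hn; lra.
exists z; split.
  apply: (sub_lim cL) => e /uz[n0 /(_ _ (leqnn _)) h].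
  by exists (u n0) => //; rewrite sqnorm_subC.
move=> w Lw; apply/eqP; apply: contraT => /sqabs_gt0 c0.
have w1 : 0 < 1 + sqnorm w by have := sqnorm_ge0 w; lra.
have e0 : 0 < sqabs (ip (x - z) w) / (4 * (1 + sqnorm w)) by rewrite divr_gt0 //; lra.
have [n1 hn1] := uz _ e0; have [n2 hn2] := small _ e0.
pose n := maxn n1 n2; have := hn1 n (leq_maxl _ _); have := hn2 n (leq_maxr _ _).
pose v := ((1 + sqnorm w)^-1%:C * ip (x - u n) w) *: w.
have := le_trans (dle _ (subD cL (Lu n) (subZ cL _ Lw) : L (u n + v))).
rewrite opprD addrA => /(_ _ (sqnorm_step (x - u n) w)) h1 hinv huz.
have h2 : sqabs (ip (x - u n) w) <= (1 + sqnorm w) * q n.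
  by rewrite -ler_pdivrMl //; have := ud n; lra.
have h3 := sqabs_ip_le (u n - z) w.
have : sqabs (ip (x - z) w) <= 2 * sqabs (ip (x - u n) w) + 2 * sqabs (ip (u n - z) w).
  have -> : x - z = (x - u n) + (u n - z) by rewrite subrKA.
  by rewrite ipDl sqabsD.
move: hinv huz; rewrite !ltr_pdivlMr; try lra; nra.
Qed.

(** One choice of the projection, which is unique only up to a null element
    ([orthoproj_uniq]). *)
Definition orthoproj L x : H := xget 0 [set z | L z /\ forall w, L w -> ip (x - z) w = 0].

Lemma orthoproj_spec L x : closed_subspace L ->
  L (orthoproj L x) /\ forall w, L w -> ip (x - orthoproj L x) w = 0.
Proof.
move=> cL; have [z hz] := projection_exists x cL.
exact: (@xgetI _ 0 [set z | L z /\ forall w, L w -> ip (x - z) w = 0] z).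
Qed.

Lemma orthoproj_in L x : closed_subspace L -> L (orthoproj L x).
Proof. by move=> cL; case: (orthoproj_spec x cL). Qed.

Lemma orthoproj_ortho L x w : closed_subspace L -> L w -> ip (x - orthoproj L x) w = 0.
Proof. by move=> cL; case: (orthoproj_spec x cL) => _; apply. Qed.

Lemma orthoproj_uniq L x z : closed_subspace L -> L z ->
  (forall w, L w -> ip (x - z) w = 0) -> sqnorm (orthoproj L x - z) = 0.
Proof.
move=> cL Lz hz; have Lp := orthoproj_in x cL.
have Lpz : L (orthoproj L x - z) by apply: subB.
rewrite /sqnorm -[X in ip X _](subrKA x) ipDl hz // -opprB ipNl orthoproj_ortho //.
by rewrite oppr0 addr0.
Qed.

Lemma orthoproj_id L x : closed_subspace L -> L x -> sqnorm (x - orthoproj L x) = 0.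
Proof.
by move=> cL Lx; rewrite sqnorm_subC; apply: orthoproj_uniq => // w _; rewrite subrr ip0l.
Qed.

(** The projections on a decreasing sequence of subspaces converge: by
    Pythagoras their squared norms decrease, and differences of these are the
    squared distances. *)
Lemma decreasing_projections (M : nat -> set H) x :
  (forall n, closed_subspace (M n)) -> (forall m n, (m <= n)%N -> M n `<=` M m) ->
  exists z, (forall n, M n z) /\
    forall w, (forall n, ip (x - orthoproj (M n) x) w = 0) -> ip (x - z) w = 0.
Proof.
move=> cM dM; pose p n := orthoproj (M n) x.
have Mp m n : (m <= n)%N -> M m (p n) by move=> mn; apply: (dM _ _ mn); apply: orthoproj_in.
have pyth m n : (m <= n)%N -> sqnorm (p m - p n) = sqnorm (p m) - sqnorm (p n).
  move=> mn; have h w : M n w -> ip (p m - p n) w = 0.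
    move=> Mw; rewrite -(subrKA x) ipDl orthoproj_ortho // addr0.
    by rewrite -opprB ipNl orthoproj_ortho ?oppr0 //; apply: dM Mw.
  have {2}-> : p m = (p m - p n) + p n by rewrite subrK.
  by rewrite (pythagoras (h _ (Mp _ _ (leqnn n)))); lra.
pose D := [set sqnorm (p n) | n in [set: nat]].
have hD : has_inf D.
  by split; [exists (sqnorm (p 0%N)), 0%N | exists 0 => _ [z _ <-]; apply: sqnorm_ge0].
have dle n : inf D <= sqnorm (p n) by apply: ge_inf; [case: hD | exists n].
have [|z pz] := ip_complete (u := p).
  move=> e e0; have [_ [n0 _ <-] hn0] := inf_adherent e0 hD.
  exists n0 => m n; wlog mn : m n / (m <= n)%N.
    move=> h hm hn; case/orP: (leq_total m n) => mn; first exact: h.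
    by have := h _ _ mn hn hm; rewrite -/(sqnorm _) sqnorm_subC.
  move=> hm _; rewrite -/(sqnorm _) pyth //.
  have := pyth _ _ hm; have := sqnorm_ge0 (p n0 - p m); have := dle n; have := dle m; lra.
exists z; split=> [n|w hw].
  apply: (sub_lim (cM n)) => e /pz[n0 /(_ (maxn n n0) (leq_maxr _ _)) h].
  by exists (p (maxn n n0)); [apply: Mp; exact: leq_maxl | rewrite sqnorm_subC].
apply: ip_approx => e /pz[n0 /(_ _ (leqnn _)) h].
exists (x - p n0); first exact: hw.
by rewrite opprB [_ + (p n0 - x)]addrC subrKA.
Qed.

End ClosedSubspaces.

(** * Conditional orthogonality *)

Section ConditionalOrthogonality.
Context (R : realType) (H : semiHilbert R).
Implicit Types (x y z w : H) (L G U : set H).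

Definition cond_ortho G1 G2 L :=
  forall x y, G1 x -> G2 y -> ip (x - orthoproj L x) (y - orthoproj L y) = 0.

(** Projecting one of the two arguments is enough. *)
Lemma ip_orthoproj_l L x y : closed_subspace L ->
  ip (x - orthoproj L x) (y - orthoproj L y) = ip (x - orthoproj L x) y.
Proof. by move=> cL; rewrite ipBr (orthoproj_ortho _ cL (orthoproj_in _ cL)) subr0. Qed.

Lemma ip_orthoproj_r L x y : closed_subspace L ->
  ip (x - orthoproj L x) (y - orthoproj L y) = ip x (y - orthoproj L y).
Proof.
move=> cL; rewrite ipBl [X in _ - X]ip_eq0C ?subr0 //.
exact: orthoproj_ortho (orthoproj_in _ cL).
Qed.

Lemma cond_ortho_sym G1 G2 L : cond_ortho G1 G2 L -> cond_ortho G2 G1 L.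
Proof. by move=> h x y Gx Gy; apply: ip_eq0C; apply: h. Qed.

Lemma cond_ortho_mono G1 G2 G1' G2' L :
  G1 `<=` G1' -> G2 `<=` G2' -> cond_ortho G1' G2' L -> cond_ortho G1 G2 L.
Proof. by move=> h1 h2 h x y /h1 Gx /h2 Gy; apply: h. Qed.

(** Conditional orthogonality of two sets of generators is enough: with one
    argument projected and kept fixed, the condition is linear and continuous
    in the other. *)
Lemma cond_ortho_cspan G1 G2 L : closed_subspace L ->
  cond_ortho G1 G2 L -> cond_ortho (cspan G1) (cspan G2) L.
Proof.
move=> cL h x y Gx Gy; rewrite ip_orthoproj_l //; apply: cspan_ortho_r Gy => {}y Gy.
rewrite -ip_orthoproj_l // ip_orthoproj_r //; apply: cspan_ortho Gx => {}x Gx.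
by rewrite -ip_orthoproj_r ?h.
Qed.

Lemma cond_ortho_extend G1 G2 L : closed_subspace L -> cond_ortho G1 G2 L ->
  cond_ortho (cspan (G1 `|` L)) (cspan (G2 `|` L)) L.
Proof.
move=> cL h; apply: cond_ortho_cspan => // x y [Gx|Lx] [Gy|Ly]; first exact: h.
all: by [rewrite null_ipr // orthoproj_id | rewrite null_ip // orthoproj_id].
Qed.

(** Elements of [U1] and [U2] do not see that the conditioning space grows inside
    [U1], because the projection of [y] on [U1] is already in [L]. *)
Lemma cond_ortho_weak_union U1 U2 L L' : closed_subspace L -> closed_subspace L' ->
  L `<=` L' -> L' `<=` U1 -> cond_ortho U1 U2 L -> cond_ortho U1 U2 L'.
Proof.
move=> cL cL' LL' LU h x y Ux Uy; rewrite ip_orthoproj_r //.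
have yU w : U1 w -> ip (y - orthoproj L y) w = 0.
  by move=> Uw; apply: ip_eq0C; rewrite -ip_orthoproj_r ?h.
rewrite -(subrKA (orthoproj L y) y) ipDr (ip_eq0C (yU x Ux)) add0r null_ipr //.
rewrite sqnorm_subC; apply: orthoproj_uniq => // [|w /LU]; first by apply: LL'; apply: orthoproj_in.
exact: yU.
Qed.

(** The conditioning space may grow on both sides at once, first inside the space
    of [G1] and then inside that of [G2].  This is how the new part of the
    conditioning process enters in the evolution in time. *)
Theorem cond_ortho_augment G1 G2 L M1 M2 : closed_subspace L ->
  M1 `<=` cspan (G1 `|` L) -> M2 `<=` cspan (G2 `|` L) -> cond_ortho G1 G2 L ->
  cond_ortho (cspan (G1 `|` L)) (cspan (G2 `|` L)) (cspan (L `|` M1 `|` M2)).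
Proof.
move=> cL h1 h2 /(cond_ortho_extend cL) h.
have c1 := cspan_subspace (L `|` M1).
have L1 : L `<=` cspan (L `|` M1) by move=> x Lx; apply: cspan_gen; left.
have /(cond_ortho_extend c1) : cond_ortho (cspan (G1 `|` L)) (cspan (G2 `|` L)) (cspan (L `|` M1)).
  apply: cond_ortho_weak_union h => //; apply: cspan_min (cspan_subspace _) _ => x [Lx|/h1 //].
  by apply: cspan_gen; right.
move=> {}h; apply: (@cond_ortho_mono _ _ (cspan (cspan (G1 `|` L) `|` cspan (L `|` M1)))
    (cspan (cspan (G2 `|` L) `|` cspan (L `|` M1)))).
- by move=> x Gx; apply: cspan_gen; left.
- by move=> x Gx; apply: cspan_gen; left.
apply/cond_ortho_sym; apply: cond_ortho_weak_union (cond_ortho_sym h) => //; try exact: cspan_subspace.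
  by apply: cspan_mono => x; left.
apply: cspan_min (cspan_subspace _) _ => x [Lx|/h2 Mx]; apply: cspan_gen; last by left.
by right; apply: cspan_gen.
Qed.

(** The bound says that the angle between the two subspaces is positive; then
    the components of a Cauchy sequence of sums are Cauchy. *)
Lemma cspan_sum L1 L2 (K : R) : closed_subspace L1 -> closed_subspace L2 ->
  (forall x z, L1 x -> L2 z -> sqnorm x <= K * sqnorm (x + z)) ->
  forall y, cspan (L1 `|` L2) y -> exists x z, [/\ L1 x, L2 z & y = x + z].
Proof.
move=> c1 c2 hK; pose S := [set y | exists x z, [/\ L1 x, L2 z & y = x + z]].
suff cS : closed_subspace S.
  apply: cspan_min => // y [Ly|Ly]; first by exists y, 0; rewrite addr0; split=> //; exact: sub0.
  by exists 0, y; rewrite add0r; split=> //; exact: sub0.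
have K1 : 0 < 1 + `|K| by have := normr_ge0 K; lra.
split=> [|_ _ [x [z [? ? ->]]] [x' [z' [? ? ->]]]|c _ [x [z [? ? ->]]]|y hy].
- by exists 0, 0; rewrite addr0; split=> //; exact: sub0.
- by exists (x + x'), (z + z'); rewrite addrACA; split=> //; exact: subD.
- by exists (c *: x), (c *: z); rewrite scalerDr; split=> //; exact: subZ.
have [q [q0 hq]] := null_sequence R.
have /choice[u hu] n : exists xz : H * H, [/\ L1 xz.1, L2 xz.2 & sqnorm (y - (xz.1 + xz.2)) < q n].
  by have [_ [x [z [? ? ->]]] ?] := hy _ (q0 n); exists (x, z).
pose x n := (u n).1; pose z n := (u n).2.
have hx n : L1 (x n) by case: (hu n).
have hz n : L2 (z n) by case: (hu n).
have hxz n : sqnorm (y - (x n + z n)) < q n by case: (hu n).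
have [|x0 hx0] := ip_complete (u := x).
  move=> e e0; have e1 : 0 < e / (4 * (1 + `|K|)) by rewrite divr_gt0 //; lra.
  have [n0 hn0] := hq _ e1; exists n0 => m n hm hn.
  have := hK _ _ (subB c1 (hx m) (hx n)) (subB c2 (hz m) (hz n)).
  rewrite addrACA -opprD => h.
  have := sqnorm_trans y (x m + z m) (x n + z n); rewrite (sqnorm_subC _ y) => h2.
  have := lt_trans (hxz m) (hn0 _ hm); have := lt_trans (hxz n) (hn0 _ hn).
  rewrite !ltr_pdivlMr; try lra; move=> h3 h4; apply: le_lt_trans h _.
  have := ler_wpM2r (sqnorm_ge0 (x m + z m - (x n + z n))) (ler_norm K).
  have := ler_wpM2l (normr_ge0 K) h2.
  have := sqnorm_ge0 (y - (x n + z n)); have := sqnorm_ge0 (y - (x m + z m)); lra.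
exists x0, (y - x0); split; last by rewrite addrC subrK.
  apply: (sub_lim c1) => e /hx0[n /(_ _ (leqnn _)) hn].
  by exists (x n) => //; rewrite sqnorm_subC.
apply: (sub_lim c2) => e e0; have e4 : 0 < e / 4 by lra.
have [n1 hn1] := hx0 _ e4; have [n2 hn2] := hq _ e4; pose n := maxn n1 n2.
exists (z n) => //; have := hn1 n (leq_maxl _ _); have := hn2 n (leq_maxr _ _).
have -> : y - x0 - z n = (y - (x n + z n)) + (x n - x0).
  by rewrite opprD [y + (- x n - z n)]addrA [RHS]addrAC subrKA.
have := hxz n; have := sqnormD_le (y - (x n + z n)) (x n - x0); rewrite /sqnorm; lra.
Qed.

End ConditionalOrthogonality.

(** * m-separation in mixed graphs *)

Section Separation.
Context (V : finType) (G : mixed_graph V).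
Implicit Types (u v w : V) (D E S : {set V}) (m : mark) (e : step).

(** Whether a walk that has arrived at [v] with mark [m] may go on along [e]
    without being blocked at [v]. *)
Definition passes S m v e : bool :=
  if ~~ is_tail m && ~~ is_tail (src_mark e) then v \in S else v \notin S.

Definition end_vertex v (p : seq (step * V)) := last v [seq x.2 | x <- p].
Definition end_mark m (p : seq (step * V)) := last m [seq tgt_mark x.1 | x <- p].

Lemma is_walk_rcons u p e v :
  is_walk G u p -> is_edge G (end_vertex u p) e v -> is_walk G u (rcons p (e, v)).
Proof.
by elim: p u => [|[e' c] p IH] u //= [uc] wp ev; split=> //; apply: IH.
Qed.

Lemma m_connecting_rcons S e c p e' v : m_connecting S ((e, c) :: p) ->
  passes S (end_mark (tgt_mark e) p) (end_vertex c p) e' ->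
  m_connecting S (rcons ((e, c) :: p) (e', v)).
Proof.
elim: p e c => [|[e1 c1] p IH] e c; first by rewrite /= /passes /collider; case: ifP.
by move=> [h1 h2] h3; split=> //; apply: (IH e1 c1).
Qed.

Lemma head_at_end_rcons p e v :
  head_at_end (rcons p (e, v)) = is_arrowhead (tgt_mark e) :> bool.
Proof. by rewrite /head_at_end rev_rcons. Qed.

Definition directed_into D : {set V} := [set v | `[< exists2 w, w \in D & directed G v w >]]%SET.

Lemma directed_intoP D v : reflect (exists2 w, w \in D & directed G v w) (v \in directed_into D).
Proof. by rewrite inE; apply: asboolP. Qed.

(** A state of a walk from [D] that is not blocked given [S] so far: the vertex
    it has reached and the mark of its last edge there.  The starting point, which
    is never a collider and will lie outside [S], behaves like an arrival by a
    tail. *)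
Inductive reach D S : V -> mark -> Prop :=
| reach_start d : d \in D -> reach D S d Tail
| reach_step u m e v : reach D S u m -> is_edge G u e v -> passes S m u e ->
    reach D S v (tgt_mark e).

Lemma reach_path D S v m : reach D S v m -> exists2 d, d \in D & exists p,
  [/\ is_walk G d p, end_vertex d p = v, end_mark Tail p = m & m_connecting S p].
Proof.
elim=> [d dD|u {}m e {}v _ [d dD [p [wp eu em cp]]] uv pas].
  by exists d => //; exists [::].
exists d => //; exists (rcons p (e, v)); split.
- by apply: is_walk_rcons; rewrite ?eu.
- by rewrite /end_vertex map_rcons last_rcons.
- by rewrite /end_mark map_rcons last_rcons.
- case: p {wp} eu em cp => [//|[e1 c1] p] eu em cp.
  apply: m_connecting_rcons => //.
  by rewrite -/(end_mark _ _) -/(end_vertex _ _) [end_mark _ _]em [end_vertex _ _]eu.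
Qed.

Inductive ancestor D : V -> Prop :=
| ancestor_self v : v \in D -> ancestor D v
| ancestor_edge v w : directed G v w -> ancestor D w -> ancestor D v.

Definition m_separated D E S := forall (d e : V) p, d \in D -> e \in E ->
  is_path G d e p -> m_blocked S p.

Lemma m_separated_reach D E S v m : [disjoint D & E]%B -> m_separated D E S ->
  v \in E -> ~ reach D S v m.
Proof.
move=> DE sep vE /reach_path[d dD [p [wp ev _ cp]]].
apply: (sep d v p) => //; split=> // p0; move: ev; rewrite p0 /= => dv.
by rewrite -dv /end_vertex /= (disjointFr DE dD) in vE.
Qed.

(** Descend from [v] until [D] or [S] is met and come back: a vertex of [D] is a
    fresh start, and a vertex of [S] opens the collider at the turning point. *)
Lemma reach_turn D E S v m : [disjoint D & E]%B -> m_separated D E S ->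
  ancestor (D :|: E :|: S) v -> v \notin S -> reach D S v m -> reach D S v Tail.
Proof.
move=> DE sep av; elim: av m => [{}v vW m|{}v w vw aw IH m].
  move: vW; rewrite !inE => /orP[/orP[vD _ _|vE _]|-> //]; first exact: reach_start.
  by move/(m_separated_reach DE sep vE).
move=> vS rv.
have rw : reach D S w Arrowhead.
  by apply: (reach_step (e := Forward) rv vw); rewrite /passes andbF.
have [wS|wS] := boolP (w \in S).
  exact: (reach_step (e := Backward) rw vw).
exact: (reach_step (e := Backward) (IH _ wS rw) vw).
Qed.

(** This turns a separation by paths into one by single edges, on the ancestral
    set of [D :|: E :|: S]: [D'] consists of what is reachable from [D], and [S]
    is cut into the vertices that a collider lets see [D'], and the others. *)
Theorem m_separated_split D E S : [disjoint D & E]%B -> [disjoint D & S]%B ->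
    [disjoint E & S]%B -> m_separated D E S ->
  exists D' E' SD SE : {set V},
    [/\ D \subset D', E \subset E', SD :|: SE = S,
        directed_into (D' :|: SD) \subset D' :|: S /\
        directed_into (E' :|: SE) \subset E' :|: S &
        forall a b, a \in D' :|: SD -> b \in E' :|: SE -> a != b /\ ~ dashed G a b].
Proof.
move=> DE DS ES sep; pose W := D :|: E :|: S.
pose r v := exists m, reach D S v m.
pose D' : {set V} := [set v | `[< [/\ ancestor W v, v \notin S & r v] >]]%SET.
pose E' : {set V} := [set v | `[< [/\ ancestor W v, v \notin S & ~ r v] >]]%SET.
pose SD : {set V} := [set v | (v \in S) && `[< exists2 m, reach D S v m & ~~ is_tail m >]]%SET.
have D'P v : reflect [/\ ancestor W v, v \notin S & r v] (v \in D').
  by rewrite inE; apply: asboolP.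
have E'P v : reflect [/\ ancestor W v, v \notin S & ~ r v] (v \in E').
  by rewrite inE; apply: asboolP.
have SDP v : reflect (v \in S /\ exists2 m, reach D S v m & ~~ is_tail m) (v \in SD).
  by rewrite inE; apply: (iffP andP) => -[? /asboolP].
have tailD v : v \in D' -> reach D S v Tail.
  by move=> /D'P[av vS [m rv]]; apply: (reach_turn DE sep av vS rv).
have anS v : v \in S -> ancestor W v.
  by move=> vS; apply: ancestor_self; rewrite !inE vS !orbT.
have sub v : v \in D' :|: SD -> ancestor W v.
  by rewrite inE => /orP[/D'P[]|/SDP[/anS]].
have subE v : v \in E' :|: (S :\: SD) -> ancestor W v.
  by rewrite inE => /orP[/E'P[]|/setDP[/anS]].
have exitD v e w : v \in D' :|: SD -> is_edge G v e w -> ~~ is_tail (src_mark e) ->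
    reach D S w (tgt_mark e).
  rewrite inE => /orP[vD|/SDP[vS [m rv tm]]] ed se.
    by apply: reach_step (tailD _ vD) ed _; case/D'P: vD.
  by apply: reach_step rv ed _; rewrite /passes tm se.
have enterE v m : v \in E' :|: (S :\: SD) -> reach D S v m -> is_tail m.
  rewrite inE => /orP[/E'P[_ _ nr] rv|/setDP[vS nv] rv]; first by case: nr; exists m.
  by apply: contraNT nv => tm; apply/SDP; split=> //; exists m.
exists D', E', SD, (S :\: SD); split.
- apply/fintype.subsetP => v vD; apply/D'P; split.
  + by apply: ancestor_self; rewrite !inE vD.
  + by rewrite (disjointFr DS vD).
  + by exists Tail; apply: reach_start.
- apply/fintype.subsetP => v vE; apply/E'P; split.
  + by apply: ancestor_self; rewrite !inE vE orbT.
  + by rewrite (disjointFr ES vE).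
  + by move=> [m /(m_separated_reach DE sep vE)].
- by apply/setP => v; rewrite !inE; case: (v \in S); rewrite /= ?andbT ?orbN ?andbF.
- split; apply/fintype.subsetP => v /directed_intoP[w hw vw].
  + rewrite inE orbC; have [//|vS] := boolP (v \in S); apply/D'P; split=> //.
      exact: ancestor_edge vw (sub _ hw).
    by exists Tail; apply: (exitD w Backward).
  + rewrite inE orbC; have [//|vS] := boolP (v \in S); apply/E'P; split=> //.
      exact: ancestor_edge vw (subE _ hw).
    move=> rv; have vD : v \in D'.
      by apply/D'P; split=> //; apply: ancestor_edge vw (subE _ hw).
    have := enterE w Arrowhead hw.
    by move/(_ (reach_step (e := Forward) (tailD _ vD) vw vS)).
move=> a b aD bE; split; last first.
  by move=> ab; have := enterE b DashedTail bE (exitD a Dashed b aD ab isT).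
apply/eqP => ab; move: bE aD; rewrite -{}ab !inE.
case/orP => [/asboolP[_ aS na]|/andP[na aS]].
  by case/orP => [/asboolP[]|/andP[aS']] //; rewrite aS' in aS.
by rewrite (negbTE na) orbF => /asboolP[_]; rewrite aS.
Qed.

End Separation.

(** * Processes in a Hilbert space *)

Section Process.
Context (R : realType) (H : semiHilbert R) (k : nat) (y : 'I_k -> R -> H).
Implicit Types (A B D E S : {set 'I_k}) (I : set R) (t u : R) (x z w : H).

(** Counterparts, for a process [y] with values in [H], of the notions for
    processes of random variables; [cond_orthE] identifies the two. *)
Definition gen A I : set H := [set x | exists2 a, a \in A & exists2 u, I u & x = y a u].
Definition history A I : set H := cspan (gen A I).
Definition past A t := history A `]-oo, t].
Definition next A t := history A `[t, t + 1].

Definition noncausal A B S := forall t, cond_ortho (next B t) (past A t) (past (S :\: A)%SET t).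
Definition noncontemp A B S := forall t, cond_ortho (next A t) (next B t) (past S t).

Definition ograph : mixed_graph 'I_k :=
  {| directed a b := a != b /\ ~ noncausal [set a]%SET [set b]%SET [set: 'I_k]%SET;
     dashed a b := a != b /\ ~ noncontemp [set a]%SET [set b]%SET [set: 'I_k]%SET |}.

Notation full := [set: 'I_k]%SET.

Lemma past_subspace A t : closed_subspace (past A t).
Proof. exact: cspan_subspace. Qed.

#[local] Hint Resolve past_subspace cspan_subspace : core.

Lemma history_mono A B I J : A \subset B -> I `<=` J -> history A I `<=` history B J.
Proof.
move=> /fintype.subsetP AB IJ; apply: cspan_mono => _ [a /AB aB [u /IJ Ju ->]].
by exists a => //; exists u.
Qed.

Lemma past_mono A B t : A \subset B -> past A t `<=` past B t.
Proof. by move=> AB; apply: history_mono. Qed.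

Lemma past_full A t : past A t `<=` past full t.
Proof. exact/past_mono/finset.subsetT. Qed.

Lemma past_le A t t' : t <= t' -> past A t `<=` past A t'.
Proof.
move=> tt; apply: history_mono => // u; rewrite /= !in_itv /= => ut.
exact: le_trans ut tt.
Qed.

Lemma past_gen a A t u : a \in A -> u <= t -> past A t (y a u).
Proof.
by move=> aA ut; apply: cspan_gen; exists a => //; exists u => //; rewrite /= in_itv.
Qed.

Lemma next_gen a A t u : a \in A -> t <= u <= t + 1 -> next A t (y a u).
Proof.
by move=> aA ut; apply: cspan_gen; exists a => //; exists u => //; rewrite /= in_itv.
Qed.

Lemma past_min A t (L : set H) : closed_subspace L ->
  (forall a u, a \in A -> u <= t -> L (y a u)) -> past A t `<=` L.
Proof.
move=> cL h; apply: cspan_min => // x [a aA [u ut ->]]; exact: h.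
Qed.

Lemma next_min A t (L : set H) : closed_subspace L ->
  (forall a u, a \in A -> t <= u <= t + 1 -> L (y a u)) -> next A t `<=` L.
Proof.
move=> cL h; apply: cspan_min => // x [a aA [u ut ->]]; exact: h.
Qed.

Lemma next_past A t : next A t `<=` past A (t + 1).
Proof. by apply: next_min => // a u aA /andP[_ ut]; apply: past_gen. Qed.

Lemma pastU A B t : past (A :|: B) t `<=` cspan (past A t `|` past B t).
Proof.
apply: past_min => // a u; rewrite inE => /orP[aA|aB] ut; apply: cspan_gen.
  by left; apply: past_gen.
by right; apply: past_gen.
Qed.

Lemma past_succ A t (L : set H) : closed_subspace L ->
  past A t `<=` L -> next A t `<=` L -> past A (t + 1) `<=` L.
Proof.
move=> cL pL nL; apply: past_min => // a u aA ut; have [ut'|/ltW tu] := leP u t.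
  exact/pL/past_gen.
by apply: nL; apply: next_gen; rewrite ?tu.
Qed.

Definition innovation a t u := y a u - orthoproj (past full t) (y a u).

Lemma innovation_ortho a t u w : past full t w -> ip (innovation a t u) w = 0.
Proof. exact: orthoproj_ortho. Qed.

Lemma innovations_ortho a b t u u' : a != b -> ~ dashed ograph a b ->
  t <= u <= t + 1 -> t <= u' <= t + 1 ->
  ip (innovation a t u) (innovation b t u') = 0.
Proof.
move=> ab nd hu hu'; have h : noncontemp [set a]%SET [set b]%SET full.
  by apply: contrapT => h; apply: nd; split.
by apply: (h t); apply: next_gen; rewrite ?inE.
Qed.

(** The hypothesis [angle] is what the spectral density condition is used for:
    the components of a sum over disjoint index sets depend continuously on it.
    So the histories of disjoint sets of components form direct sums. *)
Section Separable.
Context (angle : forall A B, [disjoint A & B]%B -> exists K : R, forall x z,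
  history A setT x -> history B setT z -> sqnorm x <= K * sqnorm (x + z)).

Lemma past_history A t : past A t `<=` history A setT.
Proof. exact: history_mono. Qed.

Lemma past_split A B t t' x : [disjoint A & B]%B -> cspan (past A t `|` past B t') x ->
  exists x1 x2, [/\ past A t x1, past B t' x2 & x = x1 + x2].
Proof.
move=> /angle[K hK]; apply: (@cspan_sum _ _ _ _ K) => // u v /past_history hu /past_history hv.
exact: hK.
Qed.

(** Apply the bound to [x] and [- x]. *)
Lemma past_direct A B t x : [disjoint A & B]%B -> past A t x -> past B t x -> sqnorm x = 0.
Proof.
move=> /angle[K hK] /past_history Ax Bx; apply/eqP; rewrite eq_le sqnorm_ge0 andbT.
have /past_history Bx' : past B t (- x) by apply: subN Bx.
by have := hK _ _ Ax Bx'; rewrite subrr sqnorm0 mulr0.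
Qed.

(** The intersection property of conditional orthogonality has its source here.
    Split [x] along [A :&: B] and [A :\: B]: the second component lies in the past
    of [A :\: B] and in that of [B], so it is null. *)
Lemma pastI A B t x : past A t x -> past B t x -> past (A :&: B)%SET t x.
Proof.
move=> Ax Bx; have dAB : [disjoint A :&: B & A :\: B]%B.
  by rewrite -setI_eq0; apply/eqP/setP => v; rewrite !inE; case: (v \in B); rewrite ?andbF.
have dDB : [disjoint A :\: B & B]%B.
  by rewrite -setI_eq0; apply/eqP/setP => v; rewrite !inE; case: (v \in B); rewrite ?andbF.
have [u [v [Iu Dv xuv]]] : exists x1 x2,
    [/\ past (A :&: B)%SET t x1, past (A :\: B)%SET t x2 & x = x1 + x2].
  by apply: past_split => //; apply: pastU; rewrite setID.
apply: (sub_null (past_subspace _ _) Iu); rewrite xuv addrAC subrr add0r.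
apply: past_direct dDB Dv _; have -> : v = x - u by rewrite xuv addrAC subrr add0r.
by apply: (subB (past_subspace _ _) Bx); apply: past_mono Iu; apply: finset.subsetIr.
Qed.

(** The prediction avoids the past of each non-parent [a] separately, hence by
    [pastI] the past of all of them. *)
Lemma prediction_local a A t u : a \in A -> t <= u <= t + 1 ->
  past (A :|: directed_into ograph A) t (orthoproj (past full t) (y a u)).
Proof.
move=> aA ut; set p := orthoproj _ _; set Q := A :|: _.
have one b : b \notin Q -> past (full :\ b)%SET t p.
  rewrite !inE negb_or => /andP[bA /asboolP nb].
  have ba : b != a by apply: contraNneq bA => ->.
  have h : noncausal [set b]%SET [set a]%SET full.
    by apply: contrapT => h; apply: nb; exists a.
  set L := past (full :\ b)%SET t; have cL : closed_subspace L := past_subspace _ _.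
  have : sqnorm (p - orthoproj L (y a u)) = 0.
    apply: orthoproj_uniq => // [|w]; first by apply: past_full (orthoproj_in _ cL).
    have -> : full = (b |: (full :\ b))%SET by rewrite finset.setD1K ?inE.
    move=> /pastU; apply: cspan_ortho_r => {}w [bw|Lw]; last exact: orthoproj_ortho.
    by rewrite -ip_orthoproj_l //; apply: (h t) => //; apply: next_gen; rewrite ?inE.
  by apply: sub_null => //; apply: orthoproj_in.
have many (s : seq 'I_k) : (forall b, b \in s -> b \notin Q) -> past (~: [set b in s])%SET t p.
  elim: s => [_|b s IH hs].
    apply: past_mono (orthoproj_in _ (past_subspace _ _)).
    by apply/fintype.subsetP => v; rewrite !inE.
  have -> : (~: [set c in b :: s] = (~: [set c in s]) :&: (full :\ b))%SET.
    by apply/setP => v; rewrite !inE negb_or andbT andbC.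
  apply: pastI; last by apply: one; apply: hs; rewrite inE eqxx.
  by apply: IH => c cs; apply: hs; rewrite inE cs orbT.
have := many (enum (~: Q)) (fun b => _); rewrite set_enum finset.setCK; apply=> b.
by rewrite mem_enum inE.
Qed.

(** The step of the evolution.  Given the conditioning space, what happens in
    [[t, t + 1]] on the side of [D] is a prediction from the past of that side plus
    innovations, and the innovations of the two sides are orthogonal to the past
    and to each other; the new part of [S] is cut between the two sides. *)
Lemma cond_ortho_evolve D E SD SE t (K : set H) : closed_subspace K -> K `<=` past full t ->
  directed_into ograph (D :|: SD) \subset D :|: (SD :|: SE) ->
  directed_into ograph (E :|: SE) \subset E :|: (SD :|: SE) ->
  (forall a b, a \in D :|: SD -> b \in E :|: SE -> a != b /\ ~ dashed ograph a b) ->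
  cond_ortho (past D t) (past E t) (cspan (past (SD :|: SE) t `|` K)) ->
  cond_ortho (past D (t + 1)) (past E (t + 1)) (cspan (past (SD :|: SE) (t + 1) `|` K)).
Proof.
move=> cK KT; set S := SD :|: SE; set L := cspan (past S t `|` K) => parD parE nd h.
have cL : closed_subspace L := cspan_subspace _.
have LT : L `<=` past full t by apply: cspan_min => // x [/past_full|/KT].
pose I A := [set x | exists2 a, a \in A & exists2 u, t <= u <= t + 1 & x = innovation a t u].
have side D' S' : S' \subset S -> directed_into ograph (D' :|: S') \subset D' :|: S ->
    forall a u, a \in D' :|: S' -> t <= u <= t + 1 ->
    cspan (past D' t `|` I (D' :|: S') `|` L) (y a u).
  move=> S'S par a u aD ut.
  rewrite -(subrK (orthoproj (past full t) (y a u)) (y a u)); apply: (subD (cspan_subspace _)).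
    by apply: cspan_gen; left; right; exists a => //; exists u.
  have : past (D' :|: S) t (orthoproj (past full t) (y a u)).
    apply: past_mono (prediction_local aD ut); rewrite finset.subUset par andbT.
    exact: finset.setUS.
  move/pastU; apply: cspan_min => // x [Dx|Sx]; apply: cspan_gen; first by left; left.
  by right; apply: cspan_gen; left.
have sideD := side D SD (finset.subsetUl _ _) parD.
have sideE := side E SE (finset.subsetUr _ _) parE.
have Tortho A x w : I A x -> past full t w -> ip x w = 0.
  by move=> [a _ [u _ ->]]; apply: innovation_ortho.
(* Every case but the first comes from the orthogonality of the innovations to
   the past, hence to [L], and of those of the two sides to each other. *)
have h' : cond_ortho (past D t `|` I (D :|: SD)) (past E t `|` I (E :|: SE)) L.
  move=> x z [Dx|Ix] [Ez|Iz]; first exact: h.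
  - rewrite ip_orthoproj_l //; apply: ip_eq0C; apply: Tortho Iz _; apply: (subB (past_subspace _ _)).
      exact: past_full Dx.
    exact: LT (orthoproj_in _ cL).
  - rewrite ip_orthoproj_r //; apply: Tortho Ix _; apply: (subB (past_subspace _ _)).
      exact: past_full Ez.
    exact: LT (orthoproj_in _ cL).
  - rewrite ip_orthoproj_r // ipBr (Tortho _ _ _ Ix (LT _ (orthoproj_in _ cL))) subr0.
    case: Ix Iz => a aD [u ut ->] [b bE [u' ut' ->]].
    by have [ab dab] := nd a b aD bE; apply: innovations_ortho.
have hD : past D (t + 1) `<=` cspan (past D t `|` I (D :|: SD) `|` L).
  apply: past_succ => // [x Dx|]; first by apply: cspan_gen; left; left.
  by apply: next_min => // a u aD; apply: sideD; rewrite inE aD.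
have hE : past E (t + 1) `<=` cspan (past E t `|` I (E :|: SE) `|` L).
  apply: past_succ => // [x Dx|]; first by apply: cspan_gen; left; left.
  by apply: next_min => // a u aD; apply: sideE; rewrite inE aD.
have hSD : next SD t `<=` cspan (past D t `|` I (D :|: SD) `|` L).
  by apply: next_min => // a u aD; apply: sideD; rewrite inE aD orbT.
have hSE : next SE t `<=` cspan (past E t `|` I (E :|: SE) `|` L).
  by apply: next_min => // a u aD; apply: sideE; rewrite inE aD orbT.
have -> : cspan (past S (t + 1) `|` K) = cspan (L `|` next SD t `|` next SE t).
  have t1 : t <= t + 1 by lra.
  apply/seteqP; split; apply: cspan_min => // x.
    case=> [|Kx]; last by apply: cspan_gen; left; left; apply: cspan_gen; right.
    move: x; apply: past_succ => // [x Sx|].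
      by apply: cspan_gen; left; left; apply: cspan_gen; left.
    apply: next_min => // a u; rewrite inE => /orP[aS|aS] ut; apply: cspan_gen.
      by left; right; apply: next_gen.
    by right; apply: next_gen.
  case=> [[|]|].
  - move: x; apply: cspan_min => // x [Sx|Kx]; apply: cspan_gen; last by right.
    by left; apply: past_le Sx.
  - move=> /next_past Sx; apply: cspan_gen; left; apply: past_mono Sx.
    exact: finset.subsetUl.
  - move=> /next_past Sx; apply: cspan_gen; left; apply: past_mono Sx.
    exact: finset.subsetUr.
exact: cond_ortho_mono hD hE (cond_ortho_augment cL hSD hSE h').
Qed.

(** At the starting time the conditioning space contains everything. *)
Lemma cond_ortho_evolve_iter D E SD SE t n :
  directed_into ograph (D :|: SD) \subset D :|: (SD :|: SE) ->
  directed_into ograph (E :|: SE) \subset E :|: (SD :|: SE) ->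
  (forall a b, a \in D :|: SD -> b \in E :|: SE -> a != b /\ ~ dashed ograph a b) ->
  cond_ortho (past D (t + n%:R)) (past E (t + n%:R))
     (cspan (past (SD :|: SE) (t + n%:R) `|` past full t)).
Proof.
move=> parD parE nd; elim: n => [|n IH].
  rewrite addr0 => x z Dx _; rewrite null_ip // orthoproj_id //.
  by apply: cspan_gen; right; apply: past_full Dx.
rewrite -natr1 addrA; apply: cond_ortho_evolve => //; apply: past_le.
by rewrite lerDl.
Qed.

Section Nondeterministic.
Context (nondet : forall x, (forall t, past full t x) -> sqnorm x = 0).

(** Decompose an element of the intersection along [S] and its complement: by
    uniqueness the second component does not depend on [n], so it lies in the
    remote past. *)
Lemma past_remote S t x :
  (forall n : nat, cspan (past S t `|` past full (t - n%:R)) x) -> past S t x.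
Proof.
move=> hx; have dS : [disjoint S & ~: S]%B by rewrite -setI_eq0 finset.setICr.
have hn n : exists x1 x2, [/\ past S t x1, past (~: S)%SET (t - n%:R) x2 & x = x1 + x2].
  apply: past_split => //; apply: (cspan_min (cspan_subspace _) _ (hx n)) => z [Sz|].
    by apply: cspan_gen; left.
  rewrite -(finset.setUCr S) => /pastU; apply: cspan_min => // w [Sw|Cw]; apply: cspan_gen;
    last by right.
  by left; apply: past_le Sw; rewrite gerBl.
have [x1 [x2 [Sx1 Cx2 xE]]] := hn 0%N; rewrite subr0 in Cx2.
have le_t n : t - n%:R <= t by rewrite gerBl.
have x2n n : past full (t - n%:R) x2.
  have [u1 [u2 [Su1 Cu2 uE]]] := hn n.
  apply: (sub_null (past_subspace _ _) (past_full Cu2)).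
  apply: (past_direct (A := ~: S) (B := S) (t := t)); first by rewrite disjoint_sym.
    by apply: (subB (past_subspace _ _) Cx2); apply: past_le Cu2.
  have -> : x2 - u2 = u1 - x1.
    by apply/eqP; rewrite subr_eq addrAC -uE xE addrAC subrr add0r.
  exact: (subB (past_subspace _ _) Su1).
apply: (sub_null (past_subspace _ _) Sx1); rewrite xE addrAC subrr add0r.
apply: nondet => s; have := x2n (Num.trunc (t - s)).+1; apply: past_le.
by rewrite lerBlDr -lerBlDl ltW // truncnS_gt.
Qed.

(** Start the evolution at time [t - n] and let [n] tend to infinity: the
    conditioning spaces decrease to the past of [S] by [past_remote], and the
    projections converge. *)
Lemma cond_ortho_of_split D E SD SE t :
  directed_into ograph (D :|: SD) \subset D :|: (SD :|: SE) ->
  directed_into ograph (E :|: SE) \subset E :|: (SD :|: SE) ->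
  (forall a b, a \in D :|: SD -> b \in E :|: SE -> a != b /\ ~ dashed ograph a b) ->
  cond_ortho (past D t) (past E t) (past (SD :|: SE) t).
Proof.
move=> parD parE nd; set S := SD :|: SE.
pose M n := cspan (past S t `|` past full (t - n%:R)).
have cM n : closed_subspace (M n) := cspan_subspace _.
have dM m n : (m <= n)%N -> M n `<=` M m.
  move=> mn; apply: cspan_mono => x [Sx|Tx]; [by left | right].
  by apply: past_le Tx; rewrite lerB // ler_nat.
have hM n : cond_ortho (past D t) (past E t) (M n).
  by have := @cond_ortho_evolve_iter D E SD SE (t - n%:R) n parD parE nd; rewrite subrK.
move=> x w Dx Ew; rewrite ip_orthoproj_l //.
have [z [Mz hz]] := decreasing_projections x cM dM.
have Sz : past S t z := past_remote Mz.
have pz : sqnorm (orthoproj (past S t) x - z) = 0.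
  apply: orthoproj_uniq => // v Sv; apply: hz => n; apply: orthoproj_ortho => //.
  by apply: cspan_gen; left.
rewrite -(subrKA z x) ipDl (hz w) => [|n]; last by rewrite -ip_orthoproj_l // hM.
by rewrite add0r null_ip // sqnorm_subC.
Qed.

(** * The global Markov property *)

(** Separation by paths becomes conditional orthogonality of the infinite pasts,
    at one and the same time: the step from the graph to the process. *)
Theorem m_separated_cond_ortho D E S t : [disjoint D & E]%B -> [disjoint D & S]%B ->
  [disjoint E & S]%B -> m_separated ograph D E S ->
  cond_ortho (past D t) (past E t) (past S t).
Proof.
move=> DE DS ES sep.
have [D' [E' [SD [SE [DD EE <- [parD parE] nd]]]]] := m_separated_split DE DS ES sep.
exact: cond_ortho_mono (past_mono DD) (past_mono EE) (cond_ortho_of_split parD parE nd).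
Qed.

Lemma disjoint_setDr A B : [disjoint A :\: B & B]%B.
Proof.
by rewrite -setI_eq0; apply/eqP/setP => v; rewrite !inE; case: (v \in B); rewrite ?andbF.
Qed.

Notation into := (directed_into ograph).

(** What matters of a prediction, given the past of [S], is the part from the
    parents outside [S]. *)
Lemma prediction_outside A S t a u : A \subset S -> a \in A -> t <= u <= t + 1 ->
  cspan (past (into A :\: S) t `|` past S t) (orthoproj (past full t) (y a u)).
Proof.
move=> /fintype.subsetP AS aA ut; apply: pastU; apply: past_mono (prediction_local aA ut).
apply/fintype.subsetP => v; rewrite !finset.in_setU finset.in_setD => /orP[/AS ->|->]; first by rewrite orbT.
by rewrite andbT orNb.
Qed.

(** The prediction of [B] is made from the past of [S = B :|: C] and of the
    parents [E] of [B] outside [S].  An open path from [A] to [E] could be prolonged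
    by an edge into [B], since its end in [E] is then a non-collider outside [S]. *)
Theorem global_noncausal A B (C : {set 'I_k}) : [disjoint A & B]%B -> [disjoint A & C]%B ->
  (forall a b p, a \in A -> b \in B -> is_path ograph a b p -> head_at_end p ->
     m_blocked (B :|: C)%SET p) ->
  noncausal A B (A :|: B :|: C).
Proof.
move=> AB AC hp t; set S := B :|: C.
have SA v : v \in A -> v \notin S.
  by move=> vA; rewrite inE (disjointFr AB vA) (disjointFr AC vA).
have -> : ((A :|: B :|: C) :\: A = S)%SET.
  apply/setP => v; rewrite !inE; have := SA v; rewrite inE.
  by case: (v \in A) => //= /(_ isT)/negbTE.
pose E := (into B :\: S)%SET.
have sep : m_separated ograph A E S.
  move=> a e p aA /setDP[/directed_intoP[b bB eb] eS] [p0 wp ep] cp.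
  apply: (hp a b (rcons p (Forward, b))) => //; last 1 first.
  - case: p p0 wp ep cp => [//|[e1 c1] p] _ wp ep cp; apply: m_connecting_rcons => //.
    by rewrite /passes andbF [end_vertex _ _]ep.
  - split; first by case: (p).
      by apply: is_walk_rcons => //; rewrite /end_vertex ep.
    by rewrite map_rcons last_rcons.
  - by rewrite head_at_end_rcons.
have AE : [disjoint A & E]%B.
  rewrite disjoint_subset; apply/fintype.subsetP => v vA; rewrite !inE.
  apply/negP => /andP[_ /asboolP[b bB vb]].
  by apply: (hp v b [:: (Forward, b)]).
have AS : [disjoint A & S]%B by rewrite disjoint_subset; apply/fintype.subsetP => v /SA.
have h := m_separated_cond_ortho (t := t) AE AS (disjoint_setDr _ _) sep.
apply: cond_ortho_cspan => // _ w [b bB [u ut ->]] Aw; rewrite /= in_itv /= in ut.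
set x := y b u; have Aw' : past A t w by apply: cspan_gen.
rewrite ip_orthoproj_r // -(subrK (orthoproj (past full t) x) x) ipDl.
rewrite innovation_ortho ?add0r; last first.
  by apply: (subB (past_subspace _ _) (past_full Aw')); apply: past_full (orthoproj_in _ _).
rewrite -ip_orthoproj_r //; apply: (cond_ortho_extend (past_subspace S t) (cond_ortho_sym h)).
  by apply: prediction_outside => //; apply: finset.subsetUl.
by apply: cspan_gen; left.
Qed.

(** Without dashed edges between [A] and [B] the innovations are orthogonal, so
    the condition is about the predictions from the parents [D] of [A] and [E] of
    [B].  An open path between these could be prolonged at both ends. *)
Theorem global_noncontemp A B (C : {set 'I_k}) : [disjoint A & B]%B ->
  (forall a b, a \in A -> b \in B -> ~ dashed ograph a b) ->
  (forall a b p, a \in A -> b \in B -> is_path ograph a b p -> bi_pointing p ->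
     m_blocked (A :|: B :|: C)%SET p) ->
  noncontemp A B (A :|: B :|: C).
Proof.
move=> AB nd hp t; set S := A :|: B :|: C.
pose D := (into A :\: S)%SET; pose E := (into B :\: S)%SET.
have sep : m_separated ograph D E S.
  move=> v w p /setDP[/directed_intoP[a aA va] vS] /setDP[/directed_intoP[b bB wb] wS].
  move=> [p0 wp ep] cp.
  apply: (hp a b ((Backward, v) :: rcons p (Forward, b))) => //; last 1 first.
  - case: p p0 wp ep cp => [//|[e1 c1] p] _ wp ep cp; rewrite -rcons_cons.
    apply: (m_connecting_rcons (p := (e1, c1) :: p)) => //.
    by rewrite /passes andbF [end_vertex _ _]ep.
  - split=> //; last by rewrite /= map_rcons last_rcons.
    by split=> //; apply: is_walk_rcons => //; rewrite /end_vertex ep.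
  - by rewrite /bi_pointing -rcons_cons head_at_end_rcons.
have DE : [disjoint D & E]%B.
  rewrite disjoint_subset; apply/fintype.subsetP => v /setDP[/directed_intoP[a aA va] vS].
  rewrite !inE; apply/negP => /andP[_ /asboolP[b bB vb]].
  by apply: (hp a b [:: (Backward, v); (Forward, b)]).
have h := m_separated_cond_ortho (t := t) DE (disjoint_setDr _ _) (disjoint_setDr _ _) sep.
apply: cond_ortho_cspan => // _ _ [a aA [u ut ->]] [b bB [u' ut' ->]].
rewrite /= !in_itv /= in ut ut'.
have AS : A \subset S by rewrite /S -finset.setUA finset.subsetUl.
have BS : B \subset S by rewrite /S (finset.setUC A) -finset.setUA finset.subsetUl.
have ST : past S t `<=` past full t by apply: past_full.
set x := y a u; set z := y b u'.
set px := orthoproj (past full t) x; set pz := orthoproj (past full t) z.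
have hp0 : ip (px - orthoproj (past S t) px) (pz - orthoproj (past S t) pz) = 0.
  by apply: (cond_ortho_extend (past_subspace S t) h); apply: prediction_outside.
have [ab dab] : a != b /\ ~ dashed ograph a b.
  split; last exact: nd.
  by apply: contraTneq aA => ->; rewrite (disjointFl AB bB).
have xE : x = innovation a t u + px by rewrite subrK.
have zE : z = innovation b t u' + pz by rewrite subrK.
have in_full v : past full t v -> past full t (v - orthoproj (past S t) v).
  by move=> Tv; apply: (subB (past_subspace _ _) Tv); apply: past_full (orthoproj_in _ _).
(* Replace [x] and then [z] by its prediction: the innovation that is dropped is
   orthogonal to what it is multiplied with. *)
rewrite ip_orthoproj_r // {1}xE ipDl [X in X + _]ipBr [X in _ - X + _]innovation_ortho ?subr0; last first.
  exact: past_full (orthoproj_in _ _).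
rewrite {1}zE ipDr innovations_ortho // [X in 0 + X + _]innovation_ortho ?addr0 ?add0r;
  last exact: orthoproj_in.
rewrite -ip_orthoproj_r // ip_orthoproj_l // zE ipDr -[X in _ + X]ip_orthoproj_l // hp0 addr0.
by apply: ip_eq0C; apply: innovation_ortho; apply: in_full; apply: orthoproj_in.
Qed.

End Nondeterministic.
End Separable.
End Process.

(** * Square-integrable real functions *)

Section SquareIntegrable.
Context (d : measure_display) (T : measurableType d) (R : realType).
Context (mu : {measure set T -> \bar R}).
Implicit Types f g : T -> R.

Local Notation itg f := (mu.-integrable [set: T] (EFin \o f)).

Lemma integrable_nneg f : measurable_fun setT f -> (forall x, 0 <= f x) ->
  (\int[mu]_x (f x)%:E < +oo)%E -> itg f.
Proof.
move=> mf f0 fy; apply/integrableP; split; first exact/measurable_EFinP.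
by under eq_integral do rewrite /= ger0_norm //.
Qed.

(** Membership in L2 without the p-norm. *)
Lemma Lfun2P f : f \in Lfun mu 2%:E <-> measurable_fun setT f /\ itg (fun x => f x ^+ 2).
Proof.
split=> [hf|[mf /integrableP[_ fy]]].
  split; last exact: Lfun2_integrable_sqr.
  by move: hf; rewrite inE => /andP[]; rewrite inE.
rewrite inE; apply/andP; split; rewrite inE //= /finite_norm unlock /Lnorm.
apply: poweR_lty; apply: le_lt_trans fy.
rewrite le_eqVlt; apply/orP; left; apply/eqP; apply: eq_integral => x _.
by rewrite /= powR_mulrn // normrX.
Qed.

Lemma itgD f g : itg f -> itg g -> itg (fun x => f x + g x).
Proof. by move=> hf hg; apply: (integrableD _ hf hg). Qed.

Lemma itgZ (a : R) f : itg f -> itg (fun x => a * f x).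
Proof. by move=> hf; apply: (integrableZl _ a hf). Qed.

Lemma Lfun2D f g : f \in Lfun mu 2%:E -> g \in Lfun mu 2%:E ->
  (fun x => f x + g x) \in Lfun mu 2%:E.
Proof.
by have [_] := @Lfun_addr_closed _ T R mu 2%:E (lee1n 2); apply.
Qed.

Lemma Lfun2Z (a : R) f : f \in Lfun mu 2%:E -> (fun x => a * f x) \in Lfun mu 2%:E.
Proof.
move=> hf; have -> : (fun x => a * f x) = (a \o* f) by apply/funext => x /=; rewrite mulrC.
by apply: Lfun_scale => //; lra.
Qed.

Lemma Lfun2N f : f \in Lfun mu 2%:E -> (fun x => - f x) \in Lfun mu 2%:E.
Proof.
by move=> /(Lfun2Z (-1)); under eq_fun do rewrite mulN1r.
Qed.

Lemma Lfun2B f g : f \in Lfun mu 2%:E -> g \in Lfun mu 2%:E ->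
  (fun x => f x - g x) \in Lfun mu 2%:E.
Proof. by move=> hf /Lfun2N; apply: Lfun2D. Qed.

Lemma Lfun2M f g : f \in Lfun mu 2%:E -> g \in Lfun mu 2%:E -> itg (fun x => f x * g x).
Proof. by move=> hf hg; apply/Lfun1_integrable; apply: Lfun2_mul_Lfun1. Qed.

Lemma Rintegral_EFin f : itg f -> ((Rintegral mu setT f)%:E = \int[mu]_x (f x)%:E)%E.
Proof. by move=> hf; rewrite /Rintegral fineK // integrable_fin_num. Qed.

Lemma ae_Rintegral_ge0 (u : T -> R) (Q : T -> Prop) : mu.-integrable setT (EFin \o u) ->
  (forall l, Q l -> 0 <= u l) -> {ae mu, forall l, Q l} -> 0 <= Rintegral mu setT u.
Proof.
move=> iu Qu hQ; have [mu' _] := integrableP _ _ _ iu.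
rewrite -lee_fin Rintegral_EFin //.
have -> : (\int[mu]_l (u l)%:E = \int[mu]_l `|u l|%:E)%E.
  apply: ae_eq_integral => //.
    by apply/measurable_EFinP; apply: measurableT_comp => //; apply/measurable_EFinP.
  by apply: filterS hQ => l /Qu ul _; rewrite ger0_norm.
by apply: integral_ge0 => l _; rewrite lee_fin.
Qed.

End SquareIntegrable.

(** * Completeness of L2 *)

Section RieszFischer.
Context (d : measure_display) (T : measurableType d) (R : realType).
Context (P : probability T R).
Implicit Types f g : T -> R.

(** Cauchy-Schwarz against the constant function, in the linearized form
    [|f| <= f ^+ 2 / (2 c) + c / 2]. *)
Lemma integral_abs_le (c : R) f : 0 < c -> f \in Lfun P 2%:E ->
  (\int[P]_x `|f x|%:E <= ((2 * c)^-1 * Rintegral P setT (fun x => f x ^+ 2) + c / 2)%:E)%E.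
Proof.
move=> c0 /Lfun2P[mf if2].
have h x : `|f x| <= (2 * c)^-1 * (f x ^+ 2) + c / 2.
  have := sqr_ge0 (`|f x| - c); rewrite sqrrB -normrX ger0_norm ?sqr_ge0 // => h0.
  by rewrite -(ler_pM2l (_ : 0 < 2 * c)) ?mulr_gt0 // mulrDr mulrA mulfV ?mul1r; [nra|nra].
have i1 : P.-integrable setT (EFin \o (fun x => (2 * c)^-1 * (f x ^+ 2))).
  exact: itgZ.
have i2 : P.-integrable setT (EFin \o (fun _ : T => c / 2)).
  by apply/Lfun1_integrable; apply: Lfun_cst.
have -> : (2 * c)^-1 * Rintegral P setT (fun x => f x ^+ 2) + c / 2 =
    Rintegral P setT (fun x => (2 * c)^-1 * f x ^+ 2 + c / 2).
  have ic : Rintegral P setT (fun _ : T => c / 2) = c / 2.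
    have -> := Rintegral_cst P measurableT (c / 2).
    by rewrite (congr1 fine (probability_setT P)) mulr1.
  by rewrite (RintegralD measurableT i1 i2) (RintegralZl _ measurableT if2) ic.
rewrite Rintegral_EFin; last exact: itgD.
apply: ge0_le_integral => //.
- by apply/measurable_EFinP; apply: measurableT_comp.
- by case/integrableP: (itgD i1 i2).
- by move=> x _; rewrite lee_fin.
Qed.

Lemma measurable_fun_limn_einf (f : (T -> \bar R)^nat) :
  (forall n, measurable_fun setT (f n)) ->
  measurable_fun setT (fun x => limn_einf (f^~ x)).
Proof.
move=> mf; have -> : (fun x => limn_einf (f^~ x)) = (fun x => - limn_esup (fun n => - f n x))%E.
  by apply/funext => x; rewrite limn_esupN oppeK.
apply: measurableT_comp => //; apply: measurable_fun_limn_esup => n.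
exact: measurableT_comp.
Qed.

Lemma limn_einf_le (a : (\bar R)^nat) (M : \bar R) (n0 : nat) :
  (forall n, (n0 <= n)%N -> (a n <= M)%E) -> (limn_einf a <= M)%E.
Proof.
move=> aM; rewrite limn_einf_lim; apply: lime_le; first exact: is_cvg_einfs.
near=> n; apply: ge_ereal_inf; exists (a (maxn n n0)) => /=; last exact/aM/leq_maxr.
by exists (maxn n n0) => //=; exact: leq_maxl.
Unshelve. all: by end_near. Qed.

(** A fast Cauchy sequence has integrable total variation, so it converges
    almost everywhere. *)
Lemma fast_cauchy_cvg (v : nat -> T -> R) :
  (forall n, v n \in Lfun P 2%:E) ->
  (forall n, Rintegral P setT (fun x => (v n.+1 x - v n x) ^+ 2) <= (2^-1 ^+ n) ^+ 2) ->
  {ae P, forall x, cvgn (v ^~ x)}.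
Proof.
move=> vL hv; pose g n x := (`|v n.+1 x - v n x|%:E : \bar R).
have mv n : measurable_fun setT (v n) by case/Lfun2P: (vL n).
have mg n : measurable_fun setT (g n).
  by apply/measurable_EFinP; apply: measurableT_comp => //; apply: measurable_funB.
have g0 n x : (0 <= g n x)%E by rewrite lee_fin.
have geo n : \sum_(0 <= i < n) (2^-1 : R) ^+ i <= 2.
  suff -> : \sum_(0 <= i < n) (2^-1 : R) ^+ i = 2 - 2 * 2^-1 ^+ n.
    by have : 0 <= (2^-1 : R) ^+ n by [apply: exprn_ge0; lra]; lra.
  elim: n => [|n IH]; first by rewrite big_nil expr0; lra.
  by rewrite big_nat_recr //= IH exprS; lra.
(* The bound [2^-1 ^+ n] on the L2 norm is also the best constant in
   [integral_abs_le]. *)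
have ig n : (\int[P]_x g n x <= (2^-1 ^+ n)%:E)%E.
  have c0 : 0 < (2^-1 : R) ^+ n by apply: exprn_gt0; lra.
  apply: le_trans (integral_abs_le c0 (Lfun2B (vL _) (vL _))) _.
  rewrite lee_fin; set c := 2^-1 ^+ n in c0 hv *.
  have h := hv n; rewrite -/c in h; clearbody c.
  have : (2 * c)^-1 * Rintegral P setT (fun x => (v n.+1 x - v n x) ^+ 2) <= (2 * c)^-1 * c ^+ 2.
    by rewrite ler_wpM2l // invr_ge0; lra.
  have -> : (2 * c)^-1 * c ^+ 2 = c / 2 by field; apply: lt0r_neq0.
  lra.
have ey : P.-integrable setT (fun x => \sum_(0 <= n <oo) g n x)%E.
  apply/integrableP; split; first exact: ge0_emeasurable_sum.
  under eq_integral do rewrite gee0_abs ?nneseries_ge0 //.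
  rewrite integral_nneseries //; apply: le_lt_trans (ltry 2).
  apply: lime_le; first by apply: is_cvg_nneseries => n _ _; apply: integral_ge0.
  near=> n; apply: (@le_trans _ _ (\sum_(0 <= i < n) (2^-1 ^+ i)%:E)%E).
    by apply: lee_sum => i _.
  by rewrite sumEFin lee_fin.
have := integrable_ae measurableT ey; apply: filterS => x /(_ I) hx.
have : cvgn (series (fun n => v n.+1 x - v n x)).
  apply: normed_cvg; apply: nondecreasing_is_cvgn.
    by apply: nondecreasing_series => n _ _; apply: normr_ge0.
  exists (fine (\sum_(0 <= n <oo) g n x)%E) => _ [n _ <-].
  rewrite -lee_fin fineK // /series /= -sumEFin.
  by apply: (nneseries_lim_ge (u_ := fun n => g n x)) => *.
have -> : series (fun n => v n.+1 x - v n x) = (fun n => v n x - v 0%N x).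
  by rewrite -[LHS]/(series (telescope (v ^~ x))) telescopeK.
move=> h; have -> : v ^~ x = (fun n => (v n x - v 0%N x) + v 0%N x).
  by apply/funext => n; rewrite subrK.
by apply: is_cvgD => //; apply: is_cvg_cst.
Unshelve. all: by end_near. Qed.

Lemma Rintegral_sqr_ge0 f : 0 <= Rintegral P setT (fun x => f x ^+ 2).
Proof. by apply: Rintegral_ge0 => x _; apply: sqr_ge0. Qed.

(** Riesz-Fischer: a subsequence [v] that is Cauchy fast enough converges almost
    everywhere, and Fatou's lemma applied to [(u n - v m) ^+ 2] shows that the
    pointwise limit is a limit in L2 of the whole sequence. *)
Theorem Lfun2_complete (u : nat -> T -> R) : (forall n, u n \in Lfun P 2%:E) ->
  (forall e : R, 0 < e -> exists n0, forall m n, (n0 <= m)%N -> (n0 <= n)%N ->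
     Rintegral P setT (fun x => (u m x - u n x) ^+ 2) < e) ->
  exists2 f, f \in Lfun P 2%:E & forall e : R, 0 < e -> exists n0, forall n, (n0 <= n)%N ->
     Rintegral P setT (fun x => (u n x - f x) ^+ 2) < e.
Proof.
move=> uL cau.
have c0 j : 0 < ((2^-1 : R) ^+ j) ^+ 2 by rewrite !exprn_gt0 //; lra.
have /choice[phi hphi] := fun j => cau _ (c0 j).
(* [psi] is increasing, above [phi], and tends to infinity. *)
pose psi j := (\sum_(i < j.+1) (phi i).+1)%N.
have psi_ge j : (phi j <= psi j)%N.
  by rewrite /psi big_ord_recr; apply: leq_trans (leqnSn _) (leq_addl _ _).
have psi_mono j i : (i <= j)%N -> (psi i <= psi j)%N.
  move=> /subnK <-; elim: (j - i)%N => [//|n IH].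
  by apply: leq_trans IH _; rewrite addSn /psi [X in (_ <= X)%N]big_ord_recr leq_addr.
pose v j := u (psi j).
have vL n : v n \in Lfun P 2%:E := uL _.
have mv n : measurable_fun setT (v n) by case/Lfun2P: (vL n).
have cv : {ae P, forall x, cvgn (v ^~ x)}.
  apply: fast_cauchy_cvg => // n; apply/ltW/hphi => //.
  by apply: leq_trans (psi_ge n) (psi_mono _ _ _).
pose f x := fine (limn_esup (fun n => (v n x)%:E)).
have mf : measurable_fun setT f.
  apply: (measurableT_comp (fine_measurable measurableT)).
  by apply: measurable_fun_limn_esup => n; apply/measurable_EFinP.
have vf : {ae P, forall x, v ^~ x @ \oo --> f x}.
  apply: filterS cv => x hx; rewrite /f.
  have vl : (fun n => (v n x)%:E) @ \oo --> (limn (v ^~ x))%:E by apply: cvg_EFin; [exact: nearW|].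
  by rewrite (cvg_limn_einf_sup vl).2.
have fatou_bound n (e : R) n0 :
    (forall m, (n0 <= m)%N -> Rintegral P setT (fun x => (u n x - v m x) ^+ 2) <= e) ->
    (\int[P]_x ((u n x - f x) ^+ 2)%:E <= e%:E)%E.
  move=> hm; have mun : measurable_fun setT (u n) by case/Lfun2P: (uL n).
  have mF m : measurable_fun setT (fun x => ((u n x - v m x) ^+ 2)%:E).
    by apply/measurable_EFinP; apply: measurable_funX; apply: measurable_funB.
  have mF2 : measurable_fun setT (fun x => ((u n x - f x) ^+ 2)%:E).
    by apply/measurable_EFinP; apply: measurable_funX; apply: measurable_funB.
  have -> : (\int[P]_x ((u n x - f x) ^+ 2)%:E =
      \int[P]_x limn_einf (fun m => ((u n x - v m x) ^+ 2)%:E))%E.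
    apply: ae_eq_integral => //; first exact: measurable_fun_limn_einf.
    apply: filterS vf => x hx _.
    suff h : (fun m => ((u n x - v m x) ^+ 2)%:E) @ \oo --> ((u n x - f x) ^+ 2)%:E.
      by rewrite (cvg_limn_einf_sup h).1.
    apply: cvg_EFin; first exact: nearW.
    by apply: cvgM; apply: cvgB => //; apply: cvg_cst.
  apply: le_trans (fatou P measurableT mF _) _.
    by move=> m x _; rewrite lee_fin sqr_ge0.
  apply: (limn_einf_le (n0 := n0)) => m /hm.
  by rewrite -lee_fin Rintegral_EFin //; case/Lfun2P: (Lfun2B (uL n) (vL m)).
have uf n (e : R) n0 :
    (forall m, (n0 <= m)%N -> Rintegral P setT (fun x => (u n x - v m x) ^+ 2) <= e) ->
    (fun x => u n x - f x) \in Lfun P 2%:E.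
  move=> /fatou_bound h; apply/Lfun2P.
  have mun : measurable_fun setT (u n) by case/Lfun2P: (uL n).
  split; first exact: measurable_funB.
  apply: integrable_nneg => [|x|]; [|exact: sqr_ge0|exact: le_lt_trans h (ltry _)].
  by apply: measurable_funX; apply: measurable_funB.
have close (e : R) : 0 < e -> exists n0, forall n, (n0 <= n)%N ->
    forall m, (n0 <= m)%N -> Rintegral P setT (fun x => (u n x - v m x) ^+ 2) <= e.
  move=> e0; have [n0 hn0] := cau _ e0.
  have psi_id m : (m <= psi m)%N.
    elim: m => [//|m IH]; rewrite /psi big_ord_recr /= addnS ltnS.
    exact: leq_trans IH (leq_addr _ _).
  exists n0 => n hn m hm; apply/ltW/hn0 => //; exact: leq_trans hm (psi_id m).
exists f.
  have [n0 hn0] := close 1 ltr01; have := Lfun2B (uL n0) (uf n0 1 n0 (hn0 n0 (leqnn _))).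
  by under eq_fun do rewrite opprB addrCA subrr addr0.
move=> e e0; have e2 : 0 < e / 2 by lra.
have [n0 hn0] := close _ e2; exists n0 => n hn.
have := fatou_bound _ _ _ (hn0 n hn).
have [_ ui] := (Lfun2P _ _).1 (uf n _ _ (hn0 n hn)).
by rewrite -Rintegral_EFin // lee_fin; lra.
Qed.

End RieszFischer.

(** * The Hilbert space of complex random variables *)

Section ComplexIntegrals.
Context (R : realType) (d : measure_display) (T : measurableType d).
Context (mu : {measure set T -> \bar R}).
Implicit Types f g : T -> R[i].

Lemma cintegrableD f g : cintegrable mu f -> cintegrable mu g ->
  cintegrable mu (fun x => f x + g x).
Proof.
move=> [f1 f2] [g1 g2]; split.
  by under eq_fun do rewrite ReD; apply: itgD.
by under eq_fun do rewrite ImD; apply: itgD.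
Qed.

Lemma cintegralD f g : cintegrable mu f -> cintegrable mu g ->
  cintegral mu (fun x => f x + g x) = cintegral mu f + cintegral mu g.
Proof.
move=> [f1 f2] [g1 g2]; apply: complexP; rewrite ?ReD ?ImD /=.
  rewrite -(RintegralD measurableT f1 g1).
  by apply: eq_Rintegral => x _; rewrite ReD.
rewrite -(RintegralD measurableT f2 g2).
by apply: eq_Rintegral => x _; rewrite ImD.
Qed.

Lemma cintegrableZ (c : R[i]) f : cintegrable mu f -> cintegrable mu (fun x => c * f x).
Proof.
move=> [f1 f2]; split; under eq_fun do rewrite ?ReM ?ImM.
  by under eq_fun do rewrite -mulNr; apply: itgD; apply: itgZ.
by apply: itgD; apply: itgZ.
Qed.

Lemma cintegralZ (c : R[i]) f : cintegrable mu f ->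
  cintegral mu (fun x => c * f x) = c * cintegral mu f.
Proof.
move=> [f1 f2]; apply: complexP; rewrite ?ReM ?ImM /=.
  rewrite -!(RintegralZl _ measurableT) // -(RintegralB measurableT (itgZ _ f1) (itgZ _ f2)).
  by apply: eq_Rintegral => x _; rewrite ReM.
rewrite -!(RintegralZl _ measurableT) // -(RintegralD measurableT (itgZ _ f2) (itgZ _ f1)).
by apply: eq_Rintegral => x _; rewrite ImM.
Qed.

Lemma cintegrable0 : cintegrable mu (fun=> 0).
Proof. by split; apply: integrable0. Qed.

Lemma cintegral0 : cintegral mu (fun=> 0) = 0.
Proof. by apply: complexP; rewrite /= Rintegral_cst // mul0r. Qed.

Lemma cintegrable_sum (I : Type) (r : seq I) (F : I -> T -> R[i]) :
  (forall i, cintegrable mu (F i)) -> cintegrable mu (fun x => \sum_(i <- r) F i x).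
Proof.
move=> hF; elim: r => [|i r IH]; under eq_fun do rewrite ?big_nil ?big_cons.
  exact: cintegrable0.
exact: cintegrableD.
Qed.

Lemma cintegral_sum (I : Type) (r : seq I) (F : I -> T -> R[i]) :
  (forall i, cintegrable mu (F i)) ->
  cintegral mu (fun x => \sum_(i <- r) F i x) = \sum_(i <- r) cintegral mu (F i).
Proof.
move=> hF; elim: r => [|i r IH]; rewrite ?big_nil ?big_cons.
  by under eq_fun do rewrite big_nil; exact: cintegral0.
under eq_fun do rewrite big_cons; rewrite cintegralD ?IH //; exact: cintegrable_sum.
Qed.

Lemma sq_integrableD f g : sq_integrable mu f -> sq_integrable mu g ->
  sq_integrable mu (fun x => f x + g x).
Proof.
move=> [f1 f2] [g1 g2]; split.
  by under eq_fun do rewrite ReD; apply: Lfun2D.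
by under eq_fun do rewrite ImD; apply: Lfun2D.
Qed.

Lemma sq_integrableZ (c : R[i]) f : sq_integrable mu f -> sq_integrable mu (fun x => c * f x).
Proof.
move=> [f1 f2]; split; under eq_fun do rewrite ?ReM ?ImM.
  by apply: Lfun2B; apply: Lfun2Z.
by apply: Lfun2D; apply: Lfun2Z.
Qed.

Lemma sq_integrable0 : sq_integrable mu (fun=> 0).
Proof.
have h : (fun=> 0 : R) \in Lfun mu 2%:E by have [h _] := @Lfun_addr_closed _ T R mu 2%:E (lee1n 2).
by split.
Qed.

Lemma cintegrable_inner f g : sq_integrable mu f -> sq_integrable mu g ->
  cintegrable mu (fun x => f x * (g x)^*).
Proof.
move=> [f1 f2] [g1 g2]; split; under eq_fun do rewrite ?ReM ?ImM ReJ ImJ.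
  under eq_fun do rewrite mulrN opprK.
  by apply: itgD; apply: Lfun2M.
under eq_fun do rewrite mulrN addrC.
by apply: itgD; [|under eq_fun do rewrite -mulrN]; apply: Lfun2M => //; apply: Lfun2N.
Qed.

Lemma Re_inner f : sq_integrable mu f -> Re (inner mu f f) =
  Rintegral mu setT (fun x => Re (f x) ^+ 2) + Rintegral mu setT (fun x => Im (f x) ^+ 2).
Proof.
move=> [f1 f2]; have [_ h1] := (Lfun2P _ _).1 f1; have [_ h2] := (Lfun2P _ _).1 f2.
rewrite -(RintegralD measurableT h1 h2) /=; apply: eq_Rintegral => x _.
by rewrite ReM ReJ ImJ mulrN opprK !expr2.
Qed.

End ComplexIntegrals.

Section L2Space.
Context (R : realType) (d : measure_display) (T : measurableType d).
Context (P : probability T R).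

(** A boolean copy of [sq_integrable], as needed for subtypes. *)
Definition sqi : {pred T -> R[i]} := mem (sq_integrable P).

Lemma sqiP (X : T -> R[i]) : reflect (sq_integrable P X) (X \in sqi).
Proof. by apply: (iffP idP) => [/set_mem|/mem_set]. Qed.

Lemma sqi_submod_closed : submod_closed sqi.
Proof.
split; first exact/sqiP/sq_integrable0.
by move=> c X Y /sqiP hX /sqiP hY; apply/sqiP/sq_integrableD => //; apply: sq_integrableZ.
Qed.

HB.instance Definition _ := GRing.isSubmodClosed.Build _ _ sqi sqi_submod_closed.

Record L2 := MkL2 { L2fun :> T -> R[i]; L2_sqi : L2fun \in sqi }.

HB.instance Definition _ := [isSub for L2fun].
HB.instance Definition _ := [Choice of L2 by <:].
HB.instance Definition _ := [SubChoice_isSubLmodule of L2 by <:].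

Lemma L2P (X : L2) : sq_integrable P X.
Proof. exact/sqiP/L2_sqi. Qed.

Lemma L2DE (X Y : L2) x : (X + Y) x = X x + Y x. Proof. by []. Qed.
Lemma L2ZE (c : R[i]) (X : L2) x : (c *: X) x = c * X x. Proof. by []. Qed.
Lemma L2BE (X Y : L2) x : (X - Y) x = X x - Y x. Proof. by []. Qed.

Definition L2ip (X Y : L2) : R[i] := inner P X Y.

Lemma L2ipDl (X Y Z : L2) : L2ip (X + Y) Z = L2ip X Z + L2ip Y Z.
Proof.
rewrite /L2ip /inner -cintegralD; try by apply: cintegrable_inner; apply: L2P.
by congr cintegral; apply/funext => x; rewrite L2DE mulrDl.
Qed.

Lemma L2ipZl c (X Z : L2) : L2ip (c *: X) Z = c * L2ip X Z.
Proof.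
rewrite /L2ip /inner -cintegralZ; last by apply: cintegrable_inner; apply: L2P.
by congr cintegral; apply/funext => x; rewrite L2ZE mulrA.
Qed.

Lemma L2ipC (X Y : L2) : L2ip Y X = (L2ip X Y)^*.
Proof.
have [_ h] := cintegrable_inner (L2P X) (L2P Y).
apply: complexP; rewrite ?ReJ ?ImJ /=.
  by apply: eq_Rintegral => x _; rewrite !ReM !ReJ !ImJ; lra.
rewrite -mulN1r -(RintegralZl _ measurableT h); apply: eq_Rintegral => x _.
by rewrite !ImM !ReJ !ImJ; lra.
Qed.

Lemma L2ip_ge0 (X : L2) : 0 <= L2ip X X.
Proof.
apply/complex_ge0P; split; last first.
  by rewrite /L2ip Re_inner ?addr_ge0 ?Rintegral_sqr_ge0 //; apply: L2P.
have := congr1 (@complex.Im R) (L2ipC X X); rewrite ImJ; lra.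
Qed.

(** Real and imaginary parts converge separately. *)
Lemma L2_complete (u : nat -> L2) :
  (forall e : R, 0 < e -> exists n0, forall m n, (n0 <= m)%N -> (n0 <= n)%N ->
     Re (L2ip (u m - u n) (u m - u n)) < e) ->
  exists X : L2, forall e : R, 0 < e -> exists n0, forall n, (n0 <= n)%N ->
     Re (L2ip (u n - X) (u n - X)) < e.
Proof.
move=> cau.
have ipE (X Y : L2) : Re (L2ip (X - Y) (X - Y)) =
    Rintegral P setT (fun x => (Re (X x) - Re (Y x)) ^+ 2) +
    Rintegral P setT (fun x => (Im (X x) - Im (Y x)) ^+ 2).
  rewrite /L2ip Re_inner; last exact: L2P.
  by congr (_ + _); apply: eq_Rintegral => x _; rewrite L2BE ?ReD ?ImD ?ReN ?ImN.
have [|e e0|f fL hf] := @Lfun2_complete _ _ _ P (fun n x => Re (u n x)).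
- by move=> n; case: (L2P (u n)).
- have [n0 h] := cau _ e0; exists n0 => m n hm hn; apply: le_lt_trans (h m n hm hn).
  by rewrite ipE lerDl Rintegral_sqr_ge0.
have [|e e0|g gL hg] := @Lfun2_complete _ _ _ P (fun n x => Im (u n x)).
- by move=> n; case: (L2P (u n)).
- have [n0 h] := cau _ e0; exists n0 => m n hm hn; apply: le_lt_trans (h m n hm hn).
  by rewrite ipE lerDr Rintegral_sqr_ge0.
have XP : (fun x => f x +i* g x) \in sqi by apply/sqiP; split.
exists (MkL2 XP) => e e0; have e2 : 0 < e / 2 by lra.
have [n1 h1] := hf _ e2; have [n2 h2] := hg _ e2; exists (maxn n1 n2) => n.
by rewrite geq_max => /andP[/h1 + /h2]; rewrite ipE /=; lra.
Qed.

Definition L2_semiHilbert : semiHilbert R :=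
  @SemiHilbert R L2 L2ip L2ipDl L2ipZl L2ipC L2ip_ge0 L2_complete.

End L2Space.

(** * Positive definite matrices *)

Local Open Scope sesquilinear_scope.

Section SesquilinearForms.
Context (C : numClosedFieldType).

Definition qf m n (M : 'M[C]_(m, n)) (x : 'cV[C]_m) (y : 'cV[C]_n) : C :=
  (x ^t* *m M *m y) 0 0.

Lemma adjM m n p (A : 'M[C]_(m, n)) (B : 'M[C]_(n, p)) : (A *m B) ^t* = B ^t* *m A ^t*.
Proof. by rewrite trmx_mul map_mxM. Qed.

Lemma adjD m n (A B : 'M[C]_(m, n)) : (A + B) ^t* = A ^t* + B ^t*.
Proof. by rewrite linearD map_mxD. Qed.

Lemma adjZ m n a (A : 'M[C]_(m, n)) : (a *: A) ^t* = Num.conj a *: A ^t*.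
Proof. by rewrite linearZ map_mxZ. Qed.

Lemma qfDl m n (M : 'M[C]_(m, n)) x y z : qf M (x + y) z = qf M x z + qf M y z.
Proof. by rewrite /qf adjD !mulmxDl mxE. Qed.

Lemma qfDr m n (M : 'M[C]_(m, n)) x y z : qf M z (x + y) = qf M z x + qf M z y.
Proof. by rewrite /qf mulmxDr mxE. Qed.

Lemma qfZl m n (M : 'M[C]_(m, n)) a x z : qf M (a *: x) z = Num.conj a * qf M x z.
Proof. by rewrite /qf adjZ -!scalemxAl mxE. Qed.

Lemma qfZr m n (M : 'M[C]_(m, n)) a x z : qf M z (a *: x) = a * qf M z x.
Proof. by rewrite /qf -!scalemxAr mxE. Qed.

Lemma qf0l m n (M : 'M[C]_(m, n)) z : qf M 0 z = 0.
Proof. by rewrite -(scale0r (0 : 'cV_m)) qfZl rmorph0 mul0r. Qed.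

Lemma qf0r m n (M : 'M[C]_(m, n)) z : qf M z 0 = 0.
Proof. by rewrite /qf mulmx0 mxE. Qed.

Lemma qf_suml m n (M : 'M[C]_(m, n)) (I : Type) (r : seq I) F z :
  qf M (\sum_(i <- r) F i) z = \sum_(i <- r) qf M (F i) z.
Proof. by apply: (big_morph (fun x => qf M x z)); [move=> x y; rewrite qfDl | rewrite qf0l]. Qed.

Lemma qf_sumr m n (M : 'M[C]_(m, n)) (I : Type) (r : seq I) F z :
  qf M z (\sum_(i <- r) F i) = \sum_(i <- r) qf M z (F i).
Proof. by apply: (big_morph (fun x => qf M z x)); [move=> x y; rewrite qfDr | rewrite qf0r]. Qed.

Lemma qf_delta m n (M : 'M[C]_(m, n)) i j : qf M (delta_mx i 0) (delta_mx j 0) = M i j.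
Proof.
rewrite /qf -mulmxA -colE mxE (bigD1 i) //= big1 => [|l li].
  by rewrite !mxE !eqxx /= rmorph1 mul1r addr0.
by rewrite !mxE (negbTE li) rmorph0 mul0r.
Qed.

Lemma qf_adj m n (M : 'M[C]_(m, n)) x y : qf (M ^t*) y x = Num.conj (qf M x y).
Proof.
rewrite /qf; transitivity (((x ^t* *m M *m y) ^t*) 0 0); last by rewrite !mxE.
by rewrite !adjM trmxCK mulmxA.
Qed.

Lemma qf_mull m n p (A : 'M[C]_(m, n)) (B : 'M[C]_(n, p)) x y :
  qf (A *m B) x y = qf B (A ^t* *m x) y.
Proof. by rewrite /qf adjM trmxCK !mulmxA. Qed.

Lemma qf_mulr m n p (A : 'M[C]_(m, n)) (B : 'M[C]_(n, p)) x y :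
  qf (A *m B) x y = qf A x (B *m y).
Proof. by rewrite /qf !mulmxA. Qed.

(** Polarization, with [x + y] and with [x + 'i *: y]. *)
Lemma qf_diag0 n (M : 'M[C]_n) : (forall x, qf M x x = 0) -> M = 0.
Proof.
move=> h; have s x y : qf M x y + qf M y x = 0.
  by have := h (x + y); rewrite qfDl !qfDr !h add0r addr0.
apply/matrixP => i j; rewrite -qf_delta mxE; set x := delta_mx i 0; set y := delta_mx j 0.
have := s x ('i *: y); rewrite qfZl qfZr conjCi mulNr -mulrBr => /eqP.
rewrite mulf_eq0 (negbTE (neq0Ci _)) /= subr_eq0 => /eqP e.
by have /eqP := s x y; rewrite -e -mulr2n mulrn_eq0 => /eqP.
Qed.

Definition posdef n (M : 'M[C]_n) := forall x : 'cV[C]_n, x != 0 -> 0 < qf M x x.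

Lemma posdef_ge0 n (M : 'M[C]_n) x : posdef M -> 0 <= qf M x x.
Proof.
move=> hM; have [->|/hM/ltW//] := eqVneq x 0; by rewrite qf0l.
Qed.

(** The form is real on the diagonal, so [M - M ^t*] vanishes there. *)
Lemma posdef_adj n (M : 'M[C]_n) : posdef M -> M ^t* = M.
Proof.
move=> hM; apply/eqP; rewrite -subr_eq0; apply/eqP/qf_diag0 => x.
rewrite /qf mulmxBr mulmxBl mxE [X in _ + X]mxE -/(qf _ _ _) -/(qf _ _ _) qf_adj.
by rewrite (CrealP (ger0_real (posdef_ge0 x hM))) subrr.
Qed.

Lemma posdef_unit n (M : 'M[C]_n) : posdef M -> M \in unitmx.
Proof.
move=> hM; rewrite -row_free_unit -kermx_eq0; apply/eqP/row_matrixP => i.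
rewrite row0; apply/eqP; apply: contraT => r0.
have x0 : (row i (kermx M)) ^t* != 0.
  by apply: contraNneq r0 => h; rewrite -[row i _]trmxCK h trmx0 map_mx0.
have := hM _ x0; rewrite /qf trmxCK -row_mul mulmx_ker row0 mul0mx mxE.
by rewrite ltxx.
Qed.

(** Diagonalize [M] in an orthonormal basis and take the inverse square roots of
    the eigenvalues. *)
Lemma posdef_inv_sqrt n (M : 'M[C]_n) : posdef M ->
  exists N, posdef N /\ N *m N = invmx M.
Proof.
move=> hM; pose U := spectralmx M; pose dg := spectral_diag M.
have UU : U \is unitarymx := spectral_unitarymx M.
have Uu := unitarymx_unit UU.
have UV : invmx U = U ^t* := invmx_unitary UU.
have ME : M = U ^t* *m diag_mx dg *m U.
  rewrite -UV; apply/orthomx_spectralP/normalmxP; by rewrite posdef_adj.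
have U1 : U *m U ^t* = 1%:M by rewrite -UV mulmxV.
have U2 : U ^t* *m U = 1%:M by rewrite -UV mulVmx.
have qd (D : 'rV[C]_n) x : qf (diag_mx D) x x = \sum_i D 0 i * (`|x i 0| ^+ 2).
  rewrite /qf mxE; apply: eq_bigr => i _.
  by rewrite mul_mx_diag !mxE normCK mulrAC mulrC [_ * x i 0]mulrC.
have dpos i : 0 < dg 0 i.
  have x0 : U ^t* *m delta_mx i 0 != 0 :> 'cV_n.
    apply: contraTneq isT => /(congr1 (mulmx U)); rewrite mulmxA U1 mul1mx mulmx0.
    by move/matrixP/(_ i 0); rewrite !mxE !eqxx => /eqP; rewrite oner_eq0.
  have := hM _ x0; rewrite {1}ME -mulmxA qf_mull qf_mulr trmxCK mulmxA U1 mul1mx.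
  by rewrite qf_delta mxE eqxx mulr1n.
pose e : 'rV[C]_n := \row_i (sqrtC (dg 0 i))^-1.
have epos i : 0 < e 0 i by rewrite mxE invr_gt0 sqrtC_gt0.
exists (U ^t* *m diag_mx e *m U); split.
  move=> x x0; rewrite -mulmxA qf_mull qf_mulr trmxCK qd.
  have [i yi] : exists i, (U *m x) i 0 != 0.
    apply/existsP; apply: contraNT x0 => /existsPn h.
    have : U *m x = 0.
      by apply/matrixP => i j; rewrite (ord1 j) [RHS]mxE; apply/eqP; have := h i; rewrite negbK.
    by move/(congr1 (mulmx (U ^t*))); rewrite mulmxA U2 mul1mx mulmx0 => ->.
  rewrite (bigD1 i) //= ltr_pwDl ?mulr_gt0 ?exprn_gt0 ?normr_gt0 //.
  by apply: sumr_ge0 => l _; rewrite mulr_ge0 ?exprn_ge0 // ltW.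
have MV : (U ^t* *m diag_mx e *m U) *m (U ^t* *m diag_mx e *m U) *m M = 1%:M.
  rewrite {1}ME !mulmxA; do 2!rewrite -[_ *m U *m U ^t*]mulmxA U1 mulmx1.
  rewrite -[_ *m diag_mx e *m diag_mx e]mulmxA -[_ *m _ *m diag_mx dg]mulmxA.
  have -> : diag_mx e *m diag_mx e *m diag_mx dg = 1%:M.
    rewrite !mulmx_diag; apply/matrixP => i j; rewrite !mxE; case: eqP => // _.
    rewrite !mulr1n -invfM -expr2 sqrtCK mulVf //; exact: lt0r_neq0.
  by rewrite mulmx1 U2.
have Mu := posdef_unit hM.
by rewrite -[LHS](mulmxK Mu) MV mul1mx.
Qed.

(** With [W = G K^-1 G^*], the hypothesis says [W <= (1 - eps) F]; and completing
    the square in [y] shows that the form of the block matrix is at least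
    [F - W]. *)
Lemma schur_bound a b (F N : 'M[C]_a) (G : 'M[C]_(a, b)) (K : 'M[C]_b) (eps : C) :
  posdef F -> posdef K -> posdef N -> N *m N = invmx F ->
  (forall x, 0 <= qf ((1 - eps)%:M - N *m G *m invmx K *m G ^t* *m N) x x) ->
  forall x y, eps * qf F x x <= qf F x x + qf G x y + qf (G ^t*) y x + qf K y y.
Proof.
move=> hF hK hN NN h x y; pose W := G *m invmx K *m G ^t*.
have [[Fu Ku] Nu] := (posdef_unit hF, posdef_unit hK, posdef_unit hN).
have [Ka Na] := (posdef_adj hK, posdef_adj hN).
have hW : 0 <= (1 - eps) * qf F x x - qf W x x.
  (* At [invmx N *m x] the outer factors [N] cancel, and the scalar part becomes
     a multiple of [F = invmx N *m invmx N]. *)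
  have := h (invmx N *m x); rewrite {1}/qf mulmxBr mulmxBl mxE [X in _ + X]mxE.
  rewrite -!/(qf _ _ _).
  have -> : N *m G *m invmx K *m G ^t* *m N = N *m W *m N by rewrite /W !mulmxA.
  have -> : qf (N *m W *m N) (invmx N *m x) (invmx N *m x) = qf W x x.
    by rewrite qf_mulr mulKVmx // qf_mull Na mulKVmx.
  have -> // : qf (1 - eps)%:M (invmx N *m x) (invmx N *m x) = (1 - eps) * qf F x x.
  have FE : F = invmx N *m invmx N.
    have FNN : F *m N *m N = 1%:M by rewrite -mulmxA NN mulmxV.
    have FN : F *m N = invmx N by rewrite -[LHS](mulmxK Nu) FNN mul1mx.
    by rewrite -[LHS](mulmxK Nu) FN.
  have NVa : (invmx N) ^t* = invmx N by rewrite trmx_inv map_invmx Na.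
  by rewrite FE qf_mull NVa /qf mul_mx_scalar -scalemxAl mxE mulmxA.
have Kg : K *m (invmx K *m G ^t* *m x) = G ^t* *m x by rewrite !mulmxA mulmxV // mul1mx.
have := posdef_ge0 (y + invmx K *m G ^t* *m x) hK; set g := invmx K *m G ^t* *m x.
have Kyg z : qf K z g = qf (G ^t*) z x by rewrite /qf -mulmxA Kg mulmxA.
have Kgy z : qf K g z = qf G x z by rewrite -{1}Ka qf_adj Kyg -qf_adj trmxCK.
have Kgg : qf K g g = qf W x x.
  by rewrite Kgy /W !qf_mulr mulmxA.
rewrite qfDl !qfDr Kgg Kyg Kgy => hg.
rewrite -subr_ge0; apply: le_trans (addr_ge0 hW hg) _; rewrite le_eqVlt; apply/orP; left.
apply/eqP; ring.
Qed.

End SesquilinearForms.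

(** * The spectral density condition bounds angles *)

Section AngleBound.
Context (R : realType) (H : semiHilbert R).
Implicit Types (x z : H) (G : set H).

(** The bound extends to closures.  Approximating with squared norms loses a
    factor 4, which is harmless: only the existence of a constant is used. *)
Lemma angle_approximable G1 G2 (K : R) : 0 <= K ->
  (forall x z, G1 x -> G2 z -> sqnorm x <= K * sqnorm (x + z)) ->
  forall x z, approximable G1 x -> approximable G2 z -> sqnorm x <= (4 * K) * sqnorm (x + z).
Proof.
move=> K0 hK x z hx hz; apply/ler_addgt0Pr => e e0.
have K1 : 0 < 2 + 16 * K by lra.
have e1 : 0 < e / (2 + 16 * K) by rewrite divr_gt0.
have [x' Gx xx] := hx _ e1; have [z' Gz zz] := hz _ e1.
rewrite !ltr_pdivlMr // in xx zz.
have h1 := hK _ _ Gx Gz; have h2 := sqnorm_trans x' x 0; rewrite !subr0 in h2.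
have h3 := sqnorm_trans (x + z) (x' + z') 0; rewrite !subr0 sqnorm_subC opprD addrACA in h3.
have h4 := sqnormD_le (x - x') (z - z').
have h5 : K * sqnorm (x' + z') <=
    K * (4 * sqnorm (x - x') + 4 * sqnorm (z - z') + 2 * sqnorm (x + z)).
  by apply: ler_wpM2l => //; lra.
have := sqnorm_ge0 (x - x'); have := sqnorm_ge0 (z - z'); nra.
Qed.

End AngleBound.

Section SpectralBound.
Context (R : realType).
Notation C := R[i].

Section Blocks.
Context (k : nat).
Implicit Types (M : 'M[C]_k) (A B : {set 'I_k}).

(** Extension by zero of a vector indexed by [A]; blocks become restrictions of
    one form. *)
Definition ext A (x : 'cV[C]_#|A|) : 'cV[C]_k := \sum_p x p 0 *: delta_mx (enum_val p) 0.

Lemma col_sum_delta n (x : 'cV[C]_n) : x = \sum_p x p 0 *: delta_mx p 0.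
Proof.
rewrite [LHS]matrix_sum_delta; apply: eq_bigr => p _; by rewrite big_ord1.
Qed.

Lemma qf_block M A B x y : qf (block M A B) x y = qf M (ext x) (ext y).
Proof.
rewrite {1}[x]col_sum_delta {1}[y]col_sum_delta !qf_suml; apply: eq_bigr => p _.
rewrite !qf_sumr; apply: eq_bigr => q _.
by rewrite !qfZl !qfZr !qf_delta mxE.
Qed.

Lemma posdef_block M A : pos_def M -> posdef (block M A A).
Proof.
move=> hM x x0; rewrite qf_block; apply: hM; apply: contraNneq x0 => e0.
apply/eqP/matrixP => p j; rewrite (ord1 j) mxE.
have /matrixP/(_ (enum_val p) 0) := e0; rewrite summxE mxE => <-.
rewrite (bigD1 p) //= !mxE !eqxx mulr1 big1 ?addr0 // => q qp.
by rewrite !mxE (inj_eq enum_val_inj) eq_sym (negbTE qp) mulr0.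
Qed.

Lemma block_adj M A B : pos_def M -> block M B A = (block M A B) ^t*.
Proof.
move=> hM; apply/matrixP => p q; rewrite !mxE.
by rewrite -[in LHS](posdef_adj hM) !mxE.
Qed.

(** The spectral density condition at one frequency, for the vectors [x] and [y]
    of the transfer functions of the two components. *)
Lemma block_bound M A B (eps : R) : pos_def M ->
  pos_semidef ((1 - eps)%:C%:M
    - inv_sqrtmx (block M A A) *m block M A B *m invmx (block M B B)
      *m block M B A *m inv_sqrtmx (block M A A)) ->
  forall x y, eps%:C * qf (block M A A) x x <=
    qf (block M A A) x x + qf (block M A B) x y + qf (block M B A) y x + qf (block M B B) y y.
Proof.
move=> hM hS x y; have hA := posdef_block (A := A) hM.
have [N hN] := posdef_inv_sqrt hA.
have [N1 N2] : posdef (inv_sqrtmx (block M A A)) /\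
    inv_sqrtmx (block M A A) *m inv_sqrtmx (block M A A) = invmx (block M A A).
  exact: (@xgetI _ 0 [set N | pos_def N /\ N *m N = invmx (block M A A)] N).
rewrite (@block_adj M A B hM) in hS *.
apply: (schur_bound (N := inv_sqrtmx (block M A A)) hA (posdef_block (A := B) hM) N1 N2) => z.
have -> : 1 - eps%:C = (1 - eps)%:C by rewrite rmorphB rmorph1.
exact: hS.
Qed.

End Blocks.

Section Fourier.
Notation mu := (@lebesgue_measure R).

Lemma cintegrable_expi (h : R) (g : R -> C) : cintegrable mu g ->
  cintegrable mu (fun l => expi (l * h) * g l).
Proof.
have bnd (t : R -> R) : continuous t -> (forall l, `|t l| <= 1) ->
    forall u, mu.-integrable setT (EFin \o u) ->
    mu.-integrable setT (EFin \o (fun l => t (l * h) * u l)).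
  move=> ct t1 u hu.
  have mt : measurable_fun [set: measurableTypeR R] (fun l : measurableTypeR R => t (l * h) : R).
    apply: (continuous_measurable_fun (f := fun l : R => t (l * h))) => l.
    apply: continuous_comp; last exact: ct.
    exact: mulrr_continuous.
  have bt : [bounded t (l * h) | l in [set: R]].
    by exists 1; split=> // M M1 l _ /=; exact: le_trans (t1 _) (ltW M1).
  have := integrableMr measurableT mt bt hu.
  by apply: eq_integrable => // l _; rewrite /= EFinM.
have c1 l : `|cos l : R| <= 1 by rewrite ler_norml cos_geN1 cos_le1.
have s1 l : `|sin l : R| <= 1 by rewrite ler_norml sin_geN1 sin_le1.
have bc := bnd _ (@continuous_cos R) c1; have bs := bnd _ (@continuous_sin R) s1.
move=> [g1 g2]; split; under eq_fun do rewrite ?ReM ?ImM /=.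
  apply: itgD; first exact: bc.
  by under eq_fun do rewrite -mulN1r; apply: itgZ; apply: bs.
by apply: itgD; [apply: bc | apply: bs].
Qed.

Lemma expiB (s t : R) : expi (s - t) = expi s * (expi t)^*.
Proof.
by apply: complexP; rewrite ?ReM ?ImM ReJ ImJ /= ?cosB ?sinB; lra.
Qed.

End Fourier.

Section SpectralProcess.
Context (d : measure_display) (T : measurableType d) (P : probability T R).
Context (k : nat) (Y : 'I_k -> R -> T -> C) (YL2 : forall v t, sq_integrable P (Y v t)).
Context (f : R -> 'M[C]_k) (Yf : spectral_density P Y f) (fpos : forall l, pos_def (f l)).
Notation mu := (@lebesgue_measure R).
Notation H := (L2_semiHilbert P).

Definition lift v t : H := MkL2 (introT (sqiP P _) (YL2 v t)).

(** The generic finite linear combination of values of the components in [A].  The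
    indices run over ['I_#|A|] to match the rows of the blocks. *)
Definition combination (A : {set 'I_k}) n (c : 'I_n -> C) (p : 'I_n -> 'I_#|A|)
    (s : 'I_n -> R) : H :=
  \sum_(i < n) c i *: lift (enum_val (p i)) (s i).

(** The vector of transfer functions of [combination c p s] at frequency [l],
    conjugated because the matrix forms are conjugate-linear on the left. *)
Definition transfer (A : {set 'I_k}) n (c : 'I_n -> C) (p : 'I_n -> 'I_#|A|) (s : 'I_n -> R)
    (l : R) : 'cV[C]_#|A| :=
  \sum_(i < n) Num.conj (c i * expi (l * s i)) *: delta_mx (p i) 0.

Lemma span_combination A x : span (gen lift A setT) x ->
  exists n c p s, x = @combination A n c p s.
Proof.
move=> [n [c [g [Gg ->]]]].
have /choice[ps hps] i : exists ps : 'I_#|A| * R, g i = lift (enum_val ps.1) ps.2.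
  have [a aA [s _ ->]] := Gg i; exists (enum_rank_in aA a, s).
  by rewrite /= enum_rankK_in.
exists n, c, (fun i => (ps i).1), (fun i => (ps i).2).
by apply: eq_bigr => i _; rewrite hps.
Qed.

Lemma spectral_ip a b s t : cintegrable mu (fun l => expi (l * (s - t)) * f l a b) /\
  ip (lift a s) (lift b t) = cintegral mu (fun l => expi (l * (s - t)) * f l a b).
Proof.
have [fi fE] := Yf a b; split; first exact: cintegrable_expi.
by rewrite -(fE t (s - t)) addrC subrK.
Qed.

(** The spectral isometry on finite combinations. *)
Lemma combination_ip A B n m (c : 'I_n -> C) p s (c' : 'I_m -> C) p' s' :
  let q l := qf (block (f l) A B) (transfer c p s l) (transfer c' p' s' l) in
  cintegrable mu q /\ ip (combination c p s) (combination c' p' s') = cintegral mu q.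
Proof.
move=> q; pose F i j l := c i * (c' j)^* *
  (expi (l * (s i - s' j)) * f l (enum_val (p i)) (enum_val (p' j))).
have qE : q = (fun l => \sum_i \sum_j F i j l).
  apply/funext => l; rewrite /q /transfer qf_suml; apply: eq_bigr => i _.
  rewrite qf_sumr; apply: eq_bigr => j _; rewrite qfZl qfZr qf_delta mxE conjCK.
  rewrite /F mulrBr expiB rmorphM /=; ring.
have iF i j : cintegrable mu (F i j).
  by apply: cintegrableZ; case: (spectral_ip (enum_val (p i)) (enum_val (p' j)) (s i) (s' j)).
have iFF i : cintegrable mu (fun l => \sum_j F i j l) by apply: cintegrable_sum.
rewrite qE; split; first exact: cintegrable_sum.
rewrite cintegral_sum // ip_suml; apply: eq_bigr => i _.
rewrite cintegral_sum // ip_sumr; apply: eq_bigr => j _.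
rewrite ipZl ipZr mulrA; have [h ->] := spectral_ip (enum_val (p i)) (enum_val (p' j)) (s i) (s' j).
by rewrite -cintegralZ.
Qed.

(** Integrate [block_bound] over the frequencies: with the spectral isometry, the
    difference of the two sides integrates to
    [sqnorm (x + z) - eps * sqnorm x]. *)
Lemma spectral_angle_span A B (eps : R) : 0 < eps ->
  {ae mu, forall l, pos_semidef ((1 - eps)%:C%:M
    - inv_sqrtmx (block (f l) A A) *m block (f l) A B *m invmx (block (f l) B B)
      *m block (f l) B A *m inv_sqrtmx (block (f l) A A))} ->
  forall x z, span (gen lift A setT) x -> span (gen lift B setT) z ->
    sqnorm x <= eps^-1 * sqnorm (x + z).
Proof.
move=> e0 hS _ _ /span_combination[n [c [p [s ->]]]] /span_combination[m [c' [p' [s' ->]]]].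
set x := combination _ _ _; set z := combination _ _ _.
have [ixx xx] := combination_ip c p s c p s; have [ixz xz] := combination_ip c p s c' p' s'.
have [izx zx] := combination_ip c' p' s' c p s; have [izz zz] := combination_ip c' p' s' c' p' s'.
rewrite -/x -/z in xx xz zx zz; set X := transfer c p s in ixx ixz izx xx xz zx.
set Z := transfer c' p' s' in ixz izx izz xz zx zz.
pose qxx l := qf (block (f l) A A) (X l) (X l); pose qxz l := qf (block (f l) A B) (X l) (Z l).
pose qzx l := qf (block (f l) B A) (Z l) (X l); pose qzz l := qf (block (f l) B B) (Z l) (Z l).
pose Q l := (qxx l + qxz l + qzx l + qzz l) + (- eps)%:C * qxx l.
have [iQ QE] : cintegrable mu Q /\ cintegral mu Q = ip (x + z) (x + z) + (- eps)%:C * ip x x.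
  have i1 := cintegrableD ixx ixz; have i2 := cintegrableD i1 izx.
  have i3 := cintegrableD i2 izz; have i4 := cintegrableZ (- eps)%:C ixx.
  split; first exact: cintegrableD i3 i4.
  rewrite (cintegralD i3 i4) (cintegralD i2 izz) (cintegralD i1 izx) (cintegralD ixx ixz) cintegralZ //.
  by rewrite -xx -xz -zx -zz ipDl !ipDr; ring.
have : 0 <= Re (cintegral mu Q).
  apply: (ae_Rintegral_ge0 _ _ hS); first by case: iQ.
  move=> l /(block_bound (fpos l)) /(_ (X l) (Z l)).
  rewrite -subr_ge0 => /complex_ge0P[_]; rewrite /Q rmorphN mulNr.
  by [].
have [r1 r2] : Re (- eps)%:C = - eps /\ Im (- eps)%:C = 0 by [].
rewrite QE ReD ReM r1 r2 mul0r subr0 -!/(sqnorm _) => h.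
by rewrite ler_pdivlMl //; lra.
Qed.

Lemma spectral_angle A B (eps : R) : 0 < eps ->
  {ae mu, forall l, pos_semidef ((1 - eps)%:C%:M
    - inv_sqrtmx (block (f l) A A) *m block (f l) A B *m invmx (block (f l) B B)
      *m block (f l) B A *m inv_sqrtmx (block (f l) A A))} ->
  exists K : R, forall x z, history lift A setT x -> history lift B setT z ->
    sqnorm x <= K * sqnorm (x + z).
Proof.
move=> e0 hS; exists (4 * eps^-1); apply: angle_approximable; last exact: spectral_angle_span.
by rewrite invr_ge0 ltW.
Qed.

End SpectralProcess.
End SpectralBound.

(** * From random variables to the Hilbert space *)

Section Transfer.
Context (R : realType) (d : measure_display) (T : measurableType d) (P : probability T R).
Context (k : nat) (Y : 'I_k -> R -> T -> R[i]) (YL2 : forall v t, sq_integrable P (Y v t)).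
Notation H := (L2_semiHilbert P).
Notation y := (lift YL2).
Implicit Types (A B S : {set 'I_k}) (I J : set R).

Lemma L2_sumE (J : Type) (r : seq J) (F : J -> H) (x : T) :
  L2fun (\sum_(i <- r) F i) x = \sum_(i <- r) L2fun (F i) x.
Proof. exact: (big_morph (fun X : H => L2fun X x)). Qed.

Lemma L2norm_lt (X : H) (e : R) : 0 < e -> (L2norm P X < e) = (sqnorm X < e ^+ 2).
Proof.
move=> e0; rewrite /L2norm -[in LHS](@ger0_norm _ e) ?ltW // -sqrtr_sqr.
by rewrite ltr_sqrt // exprn_gt0.
Qed.

(** The two closed spans differ only in the distance they use, the norm or its
    square; hence the square roots of [e] and the squares [e ^+ 2]. *)
Lemma Lspace_history A I (X : H) : Lspace P Y A I X <-> history y A I X.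
Proof.
split=> [[_ h] e e0|h].
  have s0 : 0 < Num.sqrt e by rewrite sqrtr_gt0.
  have [_ [n [c [g [Gg ->]]]]] := h _ s0.
  have /choice[au hau] i : exists au : 'I_k * R, [/\ au.1 \in A, I au.2 & g i = Y au.1 au.2].
    by have [a aA [u Iu ->]] := Gg i; exists (a, u).
  pose Z : H := \sum_(i < n) c i *: y (au i).1 (au i).2.
  have -> : X \- (fun x => \sum_(i < n) c i * g i x) = L2fun (X - Z).
    apply/funext => x; rewrite L2BE /Z L2_sumE; congr (_ - _); apply: eq_bigr => i _.
    by case: (hau i) => _ _ ->.
  rewrite (L2norm_lt (X - Z)) // sqr_sqrtr ?ltW // => hZ; exists Z => //.
  exists n, c, (fun i => y (au i).1 (au i).2); split=> // i.
  by case: (hau i) => aA Iu _; exists (au i).1 => //; exists (au i).2.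
split=> [|e e0]; first exact: L2P.
have [Z [n [c [g [Gg ->]]]]] := h _ (exprn_gt0 2 e0).
rewrite -(L2norm_lt _ e0) => hZ.
exists (fun x => \sum_(i < n) c i * L2fun (g i) x).
  exists n, c, (fun i => L2fun (g i)); split=> // i.
  by have [a aA [u Iu ->]] := Gg i; exists a => //; exists u.
rewrite [X in L2norm P X < _](_ : _ = L2fun (X - \sum_(i < n) c i *: g i)) //.
by apply/funext => x; rewrite L2BE L2_sumE.
Qed.

(** The two chosen projections need not be equal as functions, but they differ by
    a null element. *)
Lemma proj_history A I (X : H) : exists Z : H, [/\ proj P (Lspace P Y A I) X = L2fun Z,
  history y A I Z & sqnorm (orthoproj (history y A I) X - Z) = 0].
Proof.
have cL : closed_subspace (history y A I) := cspan_subspace _.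
have [Z0 [LZ0 oZ0]] := projection_exists X cL.
have toL2 (W : T -> R[i]) : Lspace P Y A I W -> exists W' : H, W = L2fun W'.
  by move=> [/sqiP hW _]; exists (MkL2 hW).
have [LZ oZ] : Lspace P Y A I (proj P (Lspace P Y A I) X) /\
    forall W, Lspace P Y A I W -> inner P (L2fun X \- proj P (Lspace P Y A I) X) W = 0.
  apply: (@xgetI _ _ [set Z | Lspace P Y A I Z /\
    forall W, Lspace P Y A I W -> inner P (L2fun X \- Z) W = 0] (L2fun Z0)).
  split; first exact/Lspace_history.
  by move=> W /[dup] /toL2[W' ->] /Lspace_history /oZ0.
have [Z ZE] := toL2 _ LZ; rewrite ZE in LZ oZ *.
have LZ' : history y A I Z by apply/Lspace_history.
exists Z; split; [by [] | exact: LZ' |]; apply: (orthoproj_uniq cL LZ').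
by move=> W /Lspace_history /oZ.
Qed.

Lemma cond_orthE A B S I J K : cond_orth P (Lspace P Y A I) (Lspace P Y B J) (Lspace P Y S K) <->
  cond_ortho (history y A I) (history y B J) (history y S K).
Proof.
have pE (X Z : H) :
    inner P (L2fun X \- proj P (Lspace P Y S K) X) (L2fun Z \- proj P (Lspace P Y S K) Z) =
    ip (X - orthoproj (history y S K) X) (Z - orthoproj (history y S K) Z).
  have [X' [-> _ hX]] := proj_history S K X; have [Z' [-> _ hZ]] := proj_history S K Z.
  rewrite -[LHS]/(ip (X - X') (Z - Z')).
  exact: ip_null_congr.
split=> h X Z.
  by move=> /Lspace_history hX /Lspace_history hZ; rewrite -pE; apply: h.
move=> /[dup] hX [/sqiP sX _] /[dup] hZ [/sqiP sZ _].
rewrite -[X]/(L2fun (MkL2 sX)) -[Z]/(L2fun (MkL2 sZ)) pE.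
by apply: h; apply/Lspace_history.
Qed.

Lemma not_causalE A B S : not_causal P Y A B S = noncausal y A B S.
Proof. by apply/propext; split=> h t; apply/cond_orthE; apply: h. Qed.

Lemma not_contemporaneousE A B S : not_contemporaneous P Y A B S = noncontemp y A B S.
Proof. by apply/propext; split=> h t; apply/cond_orthE; apply: h. Qed.

Lemma orthogonality_graphE : orthogonality_graph P Y = ograph y.
Proof.
rewrite /orthogonality_graph /ograph; congr MixedGraph; apply/funext => a; apply/funext => b.
  by rewrite not_causalE.
by rewrite not_contemporaneousE.
Qed.

Lemma null_of_ae0 (X : H) : {ae P, forall x, L2fun X x = 0} -> sqnorm X = 0.
Proof.
move=> h; apply/eqP; rewrite eq_le sqnorm_ge0 andbT -oppr_ge0.
have [i1 _] := cintegrable_inner (L2P X) (L2P X).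
have -> : - sqnorm X = Rintegral P setT (fun x => -1 * Re (L2fun X x * (L2fun X x)^*)).
  by rewrite (RintegralZl _ measurableT i1) mulN1r.
apply: (ae_Rintegral_ge0 (itgZ _ i1) _ h) => x ->.
by rewrite mul0r /= mulr0.
Qed.

Lemma purely_nondeterministicP : purely_nondeterministic P Y ->
  forall X : H, (forall t, past y [set: 'I_k]%SET t X) -> sqnorm X = 0.
Proof.
move=> h X hX; apply: null_of_ae0; suff [] : zero_space P X by [].
by rewrite -h => t _; apply/Lspace_history; apply: hX.
Qed.

End Transfer.

Unset Implicit Arguments.
Set Strict Implicit.
Set Printing Implicit Defensive.
Local Close Scope sesquilinear_scope.
Local Close Scope complex_scope.
Local Close Scope classical_set_scope.

Theorem theorem5p18 (R : realType) (d : measure_display) (T : measurableType d)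
    (P : probability T R) (k : nat) (Y : 'I_k -> R -> T -> R[i])
    (Y_stationary : centered_weakly_stationary P Y)
    (Y_continuous : mean_square_continuous P Y)
    (Y_spectral : spectral_density_condition P Y)
    (Y_nondeterministic : purely_nondeterministic P Y)
    (A B C : {set 'I_k})
    (AB : [disjoint A & B]) (AC : [disjoint A & C]) (BC : [disjoint B & C]) :
  ((forall (a b : 'I_k) (p : seq (step * 'I_k)),
      a \in A -> b \in B ->
      is_path (orthogonality_graph P Y) a b p ->
      head_at_end p -> m_blocked (B :|: C)%SET p) ->
   not_causal P Y A B (A :|: B :|: C)%SET) /\
  ((forall a b : 'I_k, a \in A -> b \in B ->
      ~ dashed (orthogonality_graph P Y) a b) ->
   (forall (a b : 'I_k) (p : seq (step * 'I_k)),
      a \in A -> b \in B ->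
      is_path (orthogonality_graph P Y) a b p ->
      bi_pointing p -> m_blocked (A :|: B :|: C)%SET p) ->
   not_contemporaneous P Y A B (A :|: B :|: C)%SET).
Proof.
have [YL2 _ _] := Y_stationary.
have [f [Yf fpos [eps [/andP[e0 _] hS]]]] := Y_spectral.
rewrite (orthogonality_graphE YL2) (not_causalE YL2) (not_contemporaneousE YL2).
have angle (D E : {set 'I_k}) : [disjoint D & E]%B -> exists K : R, forall x z,
    history (lift YL2) D setT x -> history (lift YL2) E setT z -> sqnorm x <= K * sqnorm (x + z).
  by move=> /hS; exact: (spectral_angle YL2 Yf fpos e0).
have nondet := @purely_nondeterministicP _ _ _ _ _ _ YL2 Y_nondeterministic.
split=> [hp|nd hp]; first exact: (global_noncausal angle nondet AB AC).
exact: (global_noncontemp angle nondet AB nd).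
Qed.
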